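(* Let $d\ge1$, $\sigma>0$, let $P$ be a distribution on $\mathbb{R}^d$, and let $S\sim P$, $Y=S+Z$ with $Z\sim\mathcal{N}_\sigma$ independent of $S$. For every $n\in\mathbb{N}$, $$\mathbb{E}_{P^{\otimes n}}\,\mathsf{D}_{\mathsf{KL}}\big(\hat P_{S^n}\ast\mathcal{N}_\sigma\,\big\|\,P\ast\mathcal{N}_\sigma\big)\le\frac1n I_{\chi^2}(S;Y).$$ In particular, if $P$ is $K$-subgaussian with $0<K<\frac\sigma2$, then $$\mathbb{E}_{P^{\otimes n}}\,\mathsf{D}_{\mathsf{KL}}\big(\hat P_{S^n}\ast\mathcal{N}_\sigma\,\big\|\,P\ast\mathcal{N}_\sigma\big)\le\exp\left(2d\Big(\frac K\sigma\Big)^2\frac{\sigma^2-2K^2}{\sigma^2-4K^2}\right)\frac1n,$$ and if $P$ is supported on a set of diameter $D$, then $$\mathbb{E}_{P^{\otimes n}}\,\mathsf{D}_{\mathsf{KL}}\big(\hat P_{S^n}\ast\mathcal{N}_\sigma\,\big\|\,P\ast\mathcal{N}_\sigma\big)\le\exp\left(\frac{D^2}{\sigma^2}\right)\frac1n .$$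
   Context: A distribution $P$ on $\mathbb{R}^d$ is $K$-subgaussian ($K>0$) if $X\sim P$ satisfies $\mathbb{E}\big[\exp(\alpha^T(X-\mathbb{E}X))\big]\le \exp\big(\tfrac12K^2\|\alpha\|^2\big)$ for all $\alpha\in\mathbb{R}^d$. $\mathcal{N}_\sigma=\mathcal{N}(0,\sigma^2\mathrm{I}_d)$; $S^n=(S_1,\dots,S_n)\sim P^{\otimes n}$; $\hat P_{S^n}=\frac1n\sum_{i=1}^n\delta_{S_i}$; $\ast$ is convolution of measures. $\mathsf{D}_{\mathsf{KL}}(\mu\|\nu)=\int\log\big(\frac{d\mu}{d\nu}\big)d\mu$ (natural logarithm) and $\chi^2(\mu\|\nu)=\int\big(\frac{d\mu}{d\nu}-1\big)^2d\nu$. $I_{\chi^2}(S;Y)=\chi^2(P_{S,Y}\|P_S\otimes P_Y)\in[0,\infty]$, where $P_{S,Y}$ is the joint law of $(S,Y)$ and $P_S,P_Y$ its marginals. *)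

(* Defs.v *)
From HB Require Import structures.
From mathcomp Require Import all_boot all_order all_algebra.
From mathcomp Require Import all_classical all_reals all_analysis.
From mathcomp Require Import measurable_realfun.

Set Implicit Arguments.
Unset Strict Implicit.
Unset Printing Implicit Defensive.

Import Order.TTheory GRing.Theory Num.Theory.
Import numFieldNormedType.Exports.

Local Open Scope classical_set_scope.
Local Open Scope ring_scope.

(* R^d is [d.-tuple R] with the library's product sigma-algebra (generated by
   the coordinates), i.e. the Borel one. *)

Section vectors.
Context {R : realType} {d : nat}.
Implicit Types x y : d.-tuple R.

Definition vec_add x y : d.-tuple R := [tuple tnth x i + tnth y i | i < d].
Definition vec_sub x y : d.-tuple R := [tuple tnth x i - tnth y i | i < d].
Definition vec_dot x y : R := \sum_(i < d) tnth x i * tnth y i.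
Definition vec_norm x : R := Num.sqrt (vec_dot x x).

Definition diameter (A : set (d.-tuple R)) : \bar R :=
  ereal_sup [set (vec_norm (vec_sub x y))%:E | x in A & y in A].

Definition vec_add_pair (p : d.-tuple R * d.-tuple R) := vec_add p.1 p.2.

Lemma measurable_vec_add_pair : measurable_fun setT vec_add_pair.
Proof.
apply/measurable_fun_tnthP => i.
rewrite (_ : _ \o _ = fun p : d.-tuple R * d.-tuple R =>
  tnth p.1 i + tnth p.2 i); last first.
  by apply/funext => p /=; rewrite tnth_mktuple.
apply: measurable_funD.
- exact: (measurableT_comp (measurable_tnth i) measurable_fst).
- exact: (measurableT_comp (measurable_tnth i) measurable_snd).
Qed.

End vectors.

Section product_probability.
Local Open Scope ereal_scope.
Context {d1 d2} {T1 : measurableType d1} {T2 : measurableType d2}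
  {R : realType}.
Variables (P1 : probability T1 R) (P2 : probability T2 R).

Definition prod_prob : set (T1 * T2) -> \bar R := P1 \x P2.

HB.instance Definition _ := Measure.on prod_prob.

Let prod_prob_setT : prod_prob setT = 1.
Proof.
rewrite -setXTT [LHS]product_measure1E//.
by rewrite [X in X * _]probability_setT [X in _ * X]probability_setT mule1.
Qed.

HB.instance Definition _ :=
  Measure_isProbability.Build _ _ _ prod_prob prod_prob_setT.

End product_probability.

Section power.
Local Open Scope ereal_scope.
Context {d} {T : measurableType d} {R : realType}.

Definition tuple_cons n (p : T * n.-tuple T) : n.+1.-tuple T := [tuple of p.1 :: p.2].

Lemma measurable_tuple_cons n : measurable_fun [set: T * n.-tuple T] (@tuple_cons n).
Proof. exact: measurable_cons measurable_fst measurable_snd. Qed.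

HB.instance Definition _ n :=
  isMeasurableFun.Build _ _ _ _ (@tuple_cons n) (@measurable_tuple_cons n).

Fixpoint power_prob (P : probability T R) n : probability (n.-tuple T) R :=
  match n with
  | 0 => dirac [tuple]
  | m.+1 => distribution (prod_prob P (power_prob P m)) (@tuple_cons m)
  end.

End power.

Section empirical.
Local Open Scope ereal_scope.
Context {d} {T : measurableType d} {R : realType} {n : nat}.

(* For n = 0 this is the zero measure. *)
Definition empirical (s : n.-tuple T) (A : set T) : \bar R :=
  (n%:R^-1)%:E * \sum_(i < n) \d_(tnth s i) A.

Variable s : n.-tuple T.

Let empirical0 : empirical s set0 = 0.
Proof. by rewrite /empirical big1 ?mule0// => i _; rewrite measure0. Qed.

Let empirical_ge0 A : 0 <= empirical s A.
Proof. by rewrite /empirical mule_ge0 ?lee_fin ?invr_ge0// sume_ge0. Qed.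

Let empirical_sigma_additive : semi_sigma_additive (empirical s).
Proof.
have r0 : (0 <= n%:R^-1 :> R)%R by rewrite invr_ge0.
suff [m mE] : exists m : {measure set T -> \bar R},
    forall A, m A = \sum_(i <- index_enum 'I_n) \d_(tnth s i) A.
  rewrite (_ : empirical s = mscale (NngNum r0) m).
    exact: measure_semi_sigma_additive.
  by apply/funext => A; rewrite /mscale/= mE.
elim: (index_enum _) => [|i l [m mE]].
  by exists mzero => A; rewrite big_nil.
exists (measure_add (\d_(tnth s i)) m) => A.
by rewrite big_cons -mE; exact: measure_addE.
Qed.

HB.instance Definition _ := isMeasure.Build _ _ _ (empirical s)
  empirical0 empirical_ge0 empirical_sigma_additive.

Let empirical_finite : fin_num_fun (empirical s).
Proof.
apply: lty_fin_num_fun; rewrite lte_mul_pinfty ?lee_fin ?invr_ge0//.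
by apply/lte_sum_pinfty => i _; rewrite diracT ltry.
Qed.

HB.instance Definition _ := Measure_isFinite.Build _ _ _ (empirical s)
  empirical_finite.

End empirical.

Section convolution.
Local Open Scope ereal_scope.
Context {R : realType} {d : nat}.
Variables mu nu : {finite_measure set (d.-tuple R) -> \bar R}.

Definition convolution : set (d.-tuple R) -> \bar R :=
  pushforward (mu \x nu) vec_add_pair.

Let convolution0 : convolution set0 = 0.
Proof. by rewrite /convolution /pushforward preimage_set0 measure0. Qed.

Let convolution_ge0 A : 0 <= convolution A.
Proof. exact: (measure_ge0 (mu \x nu)). Qed.

Let convolution_sigma_additive : semi_sigma_additive convolution.
Proof.
apply: measure_semi_sigma_additive; exact: measurable_vec_add_pair.
Qed.

HB.instance Definition _ := isMeasure.Build _ _ _ convolution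
  convolution0 convolution_ge0 convolution_sigma_additive.

Let convolution_finite : fin_num_fun convolution.
Proof.
apply: lty_fin_num_fun.
change ((mu \x nu) (vec_add_pair @^-1` setT) < +oo).
rewrite preimage_setT -setXTT [ltLHS]product_measure1E//.
by rewrite lte_mul_pinfty// ?fin_num_measure// ltey_eq fin_num_measure.
Qed.

HB.instance Definition _ := Measure_isFinite.Build _ _ _ convolution
  convolution_finite.

End convolution.

Section divergences.
Local Open Scope ereal_scope.
Local Open Scope charge_scope.
Context {d} {T : measurableType d} {R : realType}.
Variables mu nu : {finite_measure set T -> \bar R}.

Definition density (x : T) : R :=
  fine ('d (charge_of_finite_measure mu) '/d nu x).

(* Both divergences below are +oo when mu is not absolutely continuous w.r.t. nu.
   In [KL] the density is positive mu-almost everywhere, so that the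
   convention [ln x = 0] for [x <= 0] plays no role. *)
Definition KL : \bar R :=
  if `[< mu `<< nu >] then \int[mu]_x (ln (density x))%:E else +oo.

Definition chi2 : \bar R :=
  if `[< mu `<< nu >] then \int[nu]_x ((density x - 1) ^+ 2)%:E else +oo.

End divergences.

Section mutual_information.
Local Open Scope ereal_scope.
Context {d d1 d2} {Omega : measurableType d} {T1 : measurableType d1}
  {T2 : measurableType d2} {R : realType} (Pr : probability Omega R).
Variables (X : {RV Pr >-> T1}) (Y : {RV Pr >-> T2}).

Definition RV_pair (w : Omega) : T1 * T2 := (X w, Y w).

Lemma measurable_RV_pair : measurable_fun [set: Omega] RV_pair.
Proof. exact: measurable_fun_pair. Qed.

HB.instance Definition _ :=
  isMeasurableFun.Build _ _ _ _ RV_pair measurable_RV_pair.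

Definition chi2_information : \bar R :=
  chi2 (distribution Pr RV_pair)
    (prod_prob (distribution Pr X) (distribution Pr Y)).

Definition independent_RV : Prop :=
  forall A B, measurable A -> measurable B ->
    Pr (X @^-1` A `&` Y @^-1` B) = Pr (X @^-1` A) * Pr (Y @^-1` B).

(* Equality on measurable sets only: the values of a measure elsewhere carry
   no meaning. *)
Definition has_law (P : probability T1 R) : Prop :=
  forall A, measurable A -> distribution Pr X A = P A.

End mutual_information.

Section distributions.
Local Open Scope ereal_scope.
Context {R : realType} {d : nat}.

(* The domain of [normal_prob] is [measurableTypeR R], a copy of R with the same
   measurable sets but another display; the identity moves it to R. *)
Definition id_measurableTypeR : measurableTypeR R -> R := idfun.

HB.instance Definition _ := @isMeasurableFun.Build _ _ _ _ id_measurableTypeR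
  (@measurable_id _ _ setT).

(* N(0, sigma^2 I_d); the second parameter of [normal_prob] is the standard
   deviation. *)
Definition gaussian (sigma : R) : probability (d.-tuple R) R :=
  power_prob (distribution (normal_prob 0 sigma) id_measurableTypeR) d.

Variable P : probability (d.-tuple R) R.

Definition mean : d.-tuple R := [tuple \int[P]_x tnth x i | i < d]%R.

(* The integrability clause is the existence of the mean. *)
Definition subgaussian (K : R) : Prop :=
  [/\ (0 < K)%R,
      forall i, P.-integrable setT (fun x => (tnth x i)%:E) &
      forall a : d.-tuple R,
        \int[P]_x (expR (vec_dot a (vec_sub x mean)))%:E
        <= (expR (K ^+ 2 * vec_norm a ^+ 2 / 2))%:E].

(* [A] need not be measurable. *)
Definition supported_on (A : set (d.-tuple R)) : Prop := P.-negligible (~` A).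

End distributions.

Section expected_KL.
Local Open Scope ereal_scope.
Context {R : realType} {d : nat}.

Definition expected_KL (P : probability (d.-tuple R) R) (sigma : R) (n : nat) :
    \bar R :=
  \int[power_prob P n]_s
    KL (convolution (empirical s) (gaussian sigma))
       (convolution P (gaussian sigma)).

End expected_KL.

(* Main.v *)
Require Import Defs.
From mathcomp Require Import all_boot all_order all_algebra.
From mathcomp Require Import all_classical all_reals all_analysis.
From mathcomp Require Import measurable_realfun.
From mathcomp Require Import ring lra.

Set Implicit Arguments.
Unset Strict Implicit.
Unset Printing Implicit Defensive.

Import Order.TTheory GRing.Theory Num.Theory.
Import numFieldNormedType.Exports.

Local Open Scope classical_set_scope.
Local Open Scope ring_scope.

(** Let G = N(0, sigma^2 I_d), nu = P * G, and write e_s for the density of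
    N(s, sigma^2 I_d) with respect to G, namely
      e_s(y) = exp ((<s, y> - |s|^2 / 2) / sigma^2)       (Cameron-Martin).
    Taking G instead of the Lebesgue measure as reference makes everything
    explicit: nu has density q(y) = E_P e_S(y) with respect to G, and the
    smoothed empirical measure has density (1/n) sum_i r(S_i, .) with respect to
    nu, where r(s, y) = e_s(y) / q(y).  This ratio averages to 1 in each of its
    variables, under P in s and under nu in y.

    General bound.  Since ln x <= x - 1, the Kullback-Leibler divergence is at
    most the chi-square divergence ([KL_le_sqr_dev]).  For fixed y, the density
    (1/n) sum_i r(S_i, y) is an average of n independent variables of mean 1, so
    its variance is 1/n times that of r(S, y); integrating in y gives
      E chi2 (empirical * G || nu) = (1/n) E_P E_nu (r - 1)^2
    ([integral_sqr_dev_empirical_mean]).  As r is also the density of the law of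
    (S, Y) with respect to the product of its marginals, the last double
    integral is the chi-square information of S and Y ([chi2_informationE]).

    Explicit bounds.  By the tangent-line form of Jensen's inequality,
    1 / q <= E_P (1 / e_T), and completing the square gives
    E_G (e_s^2 / e_t) = exp (|s - t|^2 / sigma^2).  Hence
      E_P E_nu (r - 1)^2 <= E exp (|S - T|^2 / sigma^2)
    for S, T independent of law P ([sqr_dev_le_exp_sqr_dist]).  When P lives on
    a set of diameter D the right-hand side is at most exp (D^2 / sigma^2).
    When P is subgaussian, exp (|v|^2 / sigma^2) is itself a Gaussian
    exponential moment, E_G exp (sqrt 2 <v, xi> / sigma^2); exchanging the
    integrals and using the subgaussian bound for S and for T leaves
      E_G exp (2 K^2 |xi|^2 / sigma^4) = (1 - 4 K^2 / sigma^2)^(- d / 2)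
    ([exp_sqr_dist_subgaussian_le]).  The stated constant then follows from
    - ln w <= (1 / w - w) / 2 for 0 < w <= 1, that is, from t <= sinh t. *)

(** * Integrals and densities *)

Section integral_comparison.
Local Open Scope ereal_scope.
Context {d} {T : measurableType d} {R : realType}.
Variable mu : {measure set T -> \bar R}.

Import HBNNSimple.

(** The integral of a nonnegative function is a supremum over the simple
    functions below it, hence monotone for arbitrary functions; this applies to
    the divergence as a function of the sample. *)
Lemma le_integral_nonmeasurable (f g : T -> \bar R) :
  (forall x, 0 <= g x) -> (forall x, f x <= g x) ->
  \int[mu]_x f x <= \int[mu]_x g x.
Proof.
move=> g0 fg; rewrite integralE.
apply: (@le_trans _ _ (\int[mu]_x f^\+ x)).
  by rewrite -[leRHS]sube0 leeB// integral_ge0.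
rewrite ge0_integralTE// ge0_integralTE//.
apply: ereal_sup_le => _ [h hf <-]; exists h => //= x.
by rewrite (le_trans (hf x))// funeposE ge_max fg g0.
Qed.

(** Both parts of the integral are monotone, so this covers [ln] of a density,
    which may fail to be integrable. *)
Lemma le_integral_measurable (f g : T -> \bar R) :
  measurable_fun setT f -> measurable_fun setT g ->
  (forall x, f x <= g x) ->
  \int[mu]_x f x <= \int[mu]_x g x.
Proof.
move=> mf mg fg; rewrite integralE [leRHS]integralE leeB//.
  apply: ge0_le_integral => //; [exact: measurable_funepos..|].
  by move=> x _; apply: (@funepos_le _ _ setT) => //; rewrite in_setT.
apply: ge0_le_integral => //; [exact: measurable_funeneg..|].
by move=> x _; apply: (@funeneg_le _ _ setT) => //; rewrite in_setT.
Qed.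

End integral_comparison.

Lemma measurable_fun_inv_gt0 {d} {T : measurableType d} {R : realType}
    (f : T -> R) : (forall x, 0 < f x) ->
  measurable_fun setT f -> measurable_fun setT (fun x => (f x)^-1).
Proof.
move=> f0 mf; rewrite (_ : (fun _ => _) = fun x => expR (- ln (f x))).
  by do 3 apply: measurableT_comp => //.
by apply/funext => x; rewrite expRN lnK ?posrE.
Qed.

Section density.
Local Open Scope ereal_scope.
Context {d} {T : measurableType d} {R : realType}.

Definition has_density (mu nu : {measure set T -> \bar R}) (r : T -> R) :=
  forall A, measurable A -> mu A = \int[nu]_(x in A) (r x)%:E.

Section density_of_finite_measure.
Variable mu : {finite_measure set T -> \bar R}.
Variable nu : {sigma_finite_measure set T -> \bar R}.
Variable r : T -> R.
Hypothesis mr : measurable_fun setT r.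
Hypothesis r0 : forall x, (0 <= r x)%R.
Hypothesis mur : has_density mu nu r.

Lemma has_density_dominates : mu `<< nu.
Proof.
apply/null_content_dominatesP => A mA nuA; rewrite mur//.
apply: null_set_integral => //.
by apply/measurable_EFinP; exact: measurable_funTS.
Qed.

Lemma has_density_ae_eq (g : T -> \bar R) : nu.-integrable setT g ->
  (forall A, measurable A -> mu A = \int[nu]_(x in A) g x) ->
  ae_eq nu setT g (EFin \o r).
Proof.
move=> ig mug; apply: integral_ae_eq => //.
  exact/measurable_EFinP.
by move=> A _ mA; rewrite -mug// -mur.
Qed.

Lemma ge0_integral_density (f : T -> \bar R) : (forall x, 0 <= f x) ->
  measurable_fun setT f ->
  \int[mu]_x f x = \int[nu]_x (f x * (r x)%:E).
Proof.
move=> f0 mf; have dom := has_density_dominates.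
rewrite -(Radon_Nikodym_SigmaFinite.change_of_variables dom)//.
have mRN : measurable_fun setT (Radon_Nikodym_SigmaFinite.f mu nu).
  exact: measurable_int (Radon_Nikodym_SigmaFinite.f_integrable dom).
apply: ge0_ae_eq_integral => //.
- exact: emeasurable_funM.
- by apply: emeasurable_funM => //; exact/measurable_EFinP.
- by move=> x _; rewrite mule_ge0// Radon_Nikodym_SigmaFinite.f_ge0.
- by move=> x _; rewrite mule_ge0// lee_fin.
- apply: ae_eqe_mul2l; apply: has_density_ae_eq.
    exact: Radon_Nikodym_SigmaFinite.f_integrable.
  exact: Radon_Nikodym_SigmaFinite.f_integral.
Qed.

End density_of_finite_measure.

(** The variance identity E (r - 1)^2 = E r^2 - 1, written without subtraction
    so that it holds when both sides are infinite. *)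
Lemma integral_sqr_dev (nu : {finite_measure set T -> \bar R}) (r : T -> R) :
  nu setT = 1 -> measurable_fun setT r -> (forall x, (0 <= r x)%R) ->
  \int[nu]_x (r x)%:E = 1 ->
  \int[nu]_x ((r x - 1) ^+ 2)%:E + 1 = \int[nu]_x ((r x) ^+ 2)%:E.
Proof.
move=> nu1 mr r0 i1.
have msq : measurable_fun setT (fun x => ((r x - 1) ^+ 2)%:E).
  by apply/measurable_EFinP/measurable_funX/measurable_funB.
have msq' : measurable_fun setT (fun x => ((r x) ^+ 2)%:E).
  by apply/measurable_EFinP/measurable_funX.
have mr' : measurable_fun setT (fun x => (r x)%:E) by exact/measurable_EFinP.
(* (r - 1)^2 + 2 r = r^2 + 1 has only nonnegative terms. *)
have : \int[nu]_x (((r x - 1) ^+ 2)%:E + 2%:E * (r x)%:E) =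
       \int[nu]_x (((r x) ^+ 2)%:E + 1).
  by apply: eq_integral => x _; rewrite -EFinM -!EFinD; congr EFin; ring.
rewrite ge0_integralD//; last 3 first.
- by move=> x _; rewrite lee_fin sqr_ge0.
- by move=> x _; rewrite -EFinM lee_fin mulr_ge0.
- exact: measurable_funeM.
rewrite ge0_integralZl//; last by move=> x _; rewrite lee_fin.
rewrite i1 mule1 ge0_integralD//; last by move=> x _; rewrite lee_fin sqr_ge0.
have -> : \int[nu]_x (1 : \bar R) = 1.
  by rewrite integral_cst// [X in _ * X]nu1 mule1.
move=> /(congr1 (fun z : \bar R => z - 1)); rewrite addeK// => <-.
rewrite -[RHS]addeA; congr (_ + _); rewrite -[RHS]/((2 - 1)%:E).
by congr EFin; ring.
Qed.

Section divergences.
Variables mu nu : {finite_measure set T -> \bar R}.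
Variable r : T -> R.
Hypothesis mr : measurable_fun setT r.
Hypothesis mur : has_density mu nu r.
Hypothesis mu1 : mu setT = 1.
Hypothesis nu1 : nu setT = 1.

Lemma density_ae_eq : (forall x, (0 <= r x)%R) ->
  {ae nu, forall x, density mu nu x = r x}.
Proof.
move=> r0; have dom := has_density_dominates mr mur.
pose cmu : {charge set T -> \bar R} := charge_of_finite_measure mu.
have iRN : nu.-integrable setT (Radon_Nikodym cmu nu).
  exact: Radon_Nikodym_integrable.
have := has_density_ae_eq mr mur iRN
  (fun A mA => Radon_Nikodym_integral (nu := cmu) dom mA).
by apply: filterS => x /= /(_ I) e; rewrite /density e.
Qed.

Lemma chi2_density : (forall x, (0 <= r x)%R) ->
  chi2 mu nu = \int[nu]_x ((r x - 1) ^+ 2)%:E.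
Proof.
move=> r0; have dom := has_density_dominates mr mur.
rewrite /chi2 asboolT//; apply: ge0_ae_eq_integral => //.
- apply/measurable_EFinP/measurable_funX/measurable_funB => //.
  by apply: measurableT_comp.
- by apply/measurable_EFinP/measurable_funX/measurable_funB.
- by move=> x _; rewrite lee_fin sqr_ge0.
- by move=> x _; rewrite lee_fin sqr_ge0.
- by apply: filterS (density_ae_eq r0) => x /= ->.
Qed.

(** Integrate ln r <= r - 1 against mu, and use that the mu-mean of r is the
    nu-mean of r^2.  Positivity of r is essential: at a zero of r the convention
    [ln 0 = 0] would break the pointwise inequality. *)
Lemma KL_le_sqr_dev : (forall x, (0 < r x)%R) ->
  KL mu nu <= \int[nu]_x ((r x - 1) ^+ 2)%:E.
Proof.
move=> r_gt0; have r0 x : (0 <= r x)%R by exact: ltW.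
have dom := has_density_dominates mr mur.
rewrite /KL asboolT//.
have mr' : measurable_fun setT (fun x => (r x)%:E) by exact/measurable_EFinP.
have mln : measurable_fun setT (fun x => (ln (r x))%:E).
  by apply/measurable_EFinP; exact: measurableT_comp.
rewrite (ae_eq_integral (fun x => (ln (r x))%:E))//; last 2 first.
- apply/measurable_EFinP; apply: measurableT_comp => //.
  exact: measurableT_comp.
- apply: null_dominates_ae_eq dom _ => //.
  by apply: filterS (density_ae_eq r0) => x /= ->.
have i1 : \int[nu]_x (r x)%:E = 1 by rewrite -mur.
have irr : \int[mu]_x (r x)%:E = \int[nu]_x ((r x) ^+ 2)%:E.
  by rewrite (ge0_integral_density mr r0 mur).
have [/eqP ->|fin] := boolP (\int[nu]_x ((r x - 1) ^+ 2)%:E == +oo).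
  by rewrite leey.
have ir : mu.-integrable setT (fun x => (r x)%:E).
  apply/integrableP; split => //.
  under eq_integral do rewrite gee0_abs ?lee_fin//.
  by rewrite irr -integral_sqr_dev// lte_add_pinfty// ?ltry// ltey.
apply: (@le_trans _ _ (\int[mu]_x ((r x)%:E - 1))).
  apply: le_integral_measurable => //.
    by apply: emeasurable_funB.
  move=> x; rewrite -EFinB lee_fin.
  by rewrite -[in leLHS](subrKC 1%R (r x)) le_ln1Dx// ltrBrDl subrr.
rewrite integralB//=; last exact: finite_measure_integrable_cst.
by rewrite irr integral_cst// [X in _ * X]mu1 mule1 -integral_sqr_dev// addeK.
Qed.

End divergences.

End density.

(** * A hyperbolic inequality *)

Section sinh_inequality.
Context {R : realType}.

(** This is t <= sinh t; the derivative of e^t - e^(-t) - 2 t is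
    (e^t - 1)^2 / e^t. *)
Lemma expR_sub_expRN_ge (t : R) : 0 <= t -> 2 * t <= expR t - expR (- t).
Proof.
move=> t0; pose g (x : R) := expR x - expR (- x) - 2 * x.
pose dg (x : R) := expR x + expR (- x) - 2.
have dgE x : is_derive x (1 : R) g (dg x).
  have d1 : is_derive x (1 : R) (fun y : R => expR (- y)) (- expR (- x)).
    apply: is_derive_eq.
    by rewrite mulrN1.
  have d2 : is_derive x (1 : R) (fun y : R => 2 * y) 2.
    apply: is_derive_eq.
    by rewrite /GRing.scale/= mulr1.
  apply: (is_derive_eq (is_deriveB (is_deriveB (is_derive_expR x) d1) d2)).
  by rewrite opprK.
have [|c _ gE] := @MVT_segment R g dg 0 t t0.
  apply: continuous_subspaceT => x; apply: differentiable_continuous.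
  by apply/derivable1_diffP; exact: ex_derive.
have : 0 <= g t - g 0.
  rewrite gE subr0 mulr_ge0// /dg expRN.
  have e0 := expR_gt0 c.
  rewrite (_ : _ - 2 = (expR c - 1) ^+ 2 / expR c).
    by rewrite divr_ge0 ?sqr_ge0 ?ltW.
  by field; rewrite gt_eqF.
by rewrite /g oppr0 subrr mulr0 !subr0 subr_ge0.
Qed.

(** The previous inequality at w = e^(-t). *)
Lemma sqrtV_le_expR (w : R) : 0 < w -> w <= 1 ->
  (Num.sqrt w)^-1 <= expR ((w^-1 - w) / 4).
Proof.
move=> w0 w1.
have [t t0 ->] : exists2 t, 0 <= t & w = expR (- t).
  by exists (- ln w); rewrite ?oppr_ge0 ?ln_le0// opprK lnK.
have -> : Num.sqrt (expR (- t)) = expR (- (t / 2)).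
  rewrite -[RHS]ger0_norm ?expR_ge0// -sqrtr_sqr expr2 -expRD.
  by congr (Num.sqrt (expR _)); field.
rewrite -!expRN !opprK ler_expR.
by have := expR_sub_expRN_ge t0; lra.
Qed.

End sinh_inequality.

(** * Translates of Gaussian measures *)

Section lebesgue_shift.
Local Open Scope ereal_scope.
Context {R : realType}.
Local Notation leb := (@lebesgue_measure R).

Let shift_measurable (a : R) :
  measurable_fun [set: measurableTypeR R] ((+%R a) : _ -> measurableTypeR R).
Proof. exact: measurable_funD. Qed.

Lemma lebesgue_measure_shift (a : R) (A : set R) : measurable A ->
  pushforward leb (+%R a : _ -> measurableTypeR R) A = leb A.
Proof.
move=> mA; apply/esym; move: A mA.
apply: lebesgue_measure_unique => //= _ [[b c]] _ <-.
rewrite /pushforward.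
rewrite (_ : _ @^-1` _ = [set` `](b - a)%R, (c - a)%R]]); last first.
  by apply/seteqP; split=> x /=; rewrite !in_itv/= ltrBlDl lerBrDl.
rewrite !lebesgue_measure_itv/= !lte_fin ltrD2r.
by case: ifP => // _; rewrite -!EFinB; congr EFin; ring.
Qed.

Lemma ge0_integral_lebesgue_shift (a : R) (f : R -> \bar R) :
  measurable_fun setT f -> (forall x, 0 <= f x) ->
  \int[leb]_x f (a + x)%R = \int[leb]_x f x.
Proof.
move=> mf f0.
have <- : \int[pushforward leb (+%R a : _ -> measurableTypeR R)]_x f x =
          \int[leb]_x f x.
  by apply: eq_measure_integral => /= A mA _; exact: lebesgue_measure_shift.
by rewrite ge0_integral_pushforward.
Qed.

End lebesgue_shift.

Section normal.
Local Open Scope ereal_scope.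
Context {R : realType}.
Variable sigma : R.
Hypothesis sigma_gt0 : (0 < sigma)%R.
Local Notation leb := (@lebesgue_measure R).
Local Notation N :=
  (distribution (normal_prob 0 sigma) (@id_measurableTypeR R)).

Lemma ge0_integral_normal (f : R -> \bar R) :
  measurable_fun setT f -> (forall x, 0 <= f x) ->
  \int[N]_x f x = \int[leb]_x (f x * (normal_pdf 0 sigma x)%:E).
Proof.
move=> mf f0; rewrite ge0_integral_distribution//.
rewrite (@ge0_integral_density _ _ _ (normal_prob 0 sigma) leb
  (normal_pdf 0 sigma))//.
- exact: measurable_normal_pdf.
- by move=> x; exact: normal_pdf_ge0.
Qed.

(** The density of N(a, sigma^2) with respect to N(0, sigma^2). *)
Definition tilt1 (a y : R) : R := expR ((a * y - a ^+ 2 / 2) / sigma ^+ 2).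

Let complete_square (a x : R) :
  (- (x - 0) ^+ 2 / (sigma ^+ 2 *+ 2) =
   (a * (a + x) - a ^+ 2 / 2) / sigma ^+ 2 +
   - (a + x - 0) ^+ 2 / (sigma ^+ 2 *+ 2))%R.
Proof. by rewrite !subr0; field; rewrite gt_eqF. Qed.

Lemma normal_shift (a : R) (f : R -> \bar R) :
  measurable_fun setT f -> (forall x, 0 <= f x) ->
  \int[N]_z f (a + z)%R = \int[N]_y (f y * (tilt1 a y)%:E).
Proof.
move=> mf f0; have s0 : sigma != 0%R by rewrite gt_eqF.
have mt : measurable_fun setT (tilt1 a).
  apply: measurableT_comp => //; apply: measurable_funM => //.
  by apply: measurable_funB => //; exact: measurable_funM.
rewrite ge0_integral_normal//; last first.
  by apply: (measurableT_comp mf); exact: measurable_funD.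
rewrite ge0_integral_normal//; first last.
- by move=> x; rewrite mule_ge0// lee_fin expR_ge0.
- by apply: emeasurable_funM => //; exact/measurable_EFinP.
rewrite -[RHS](ge0_integral_lebesgue_shift a); first last.
- by move=> x; rewrite !mule_ge0// lee_fin ?expR_ge0// normal_pdf_ge0.
- apply: emeasurable_funM.
    by apply: emeasurable_funM => //; exact/measurable_EFinP.
  by apply/measurable_EFinP; exact: measurable_normal_pdf.
apply: eq_integral => x _; rewrite -muleA; congr (_ * _).
rewrite -EFinM normal_pdfE//; congr EFin.
rewrite mulrCA /tilt1 /normal_fun -expRD; congr (_ * expR _)%R.
exact: complete_square.
Qed.

Let rescale_square (c x w : R) : (w != 0)%R ->
  (w = 1 - 2 * c * sigma ^+ 2)%R ->
  (c * x ^+ 2 + - (x - 0) ^+ 2 / (sigma ^+ 2 *+ 2) =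
   - (x - 0) ^+ 2 / (sigma ^+ 2 / w *+ 2))%R.
Proof.
by move=> w0 wE; rewrite !subr0 wE; field; rewrite -wE w0 gt_eqF.
Qed.

(** exp (c x^2) times the density of N(0, sigma^2) is a multiple of the density
    of N(0, tau^2) with tau^2 = sigma^2 / (1 - 2 c sigma^2). *)
Lemma integral_normal_expR_sqr (c : R) : (2 * c * sigma ^+ 2 < 1)%R ->
  \int[N]_x (expR (c * x ^+ 2))%:E =
  ((Num.sqrt (1 - 2 * c * sigma ^+ 2))^-1)%:E.
Proof.
move=> hc; have s0 : sigma != 0%R by rewrite gt_eqF.
set w := (1 - 2 * c * sigma ^+ 2)%R.
have w0 : (0 < w)%R by rewrite subr_gt0.
have sw0 : (0 < Num.sqrt w)%R by rewrite sqrtr_gt0.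
set tau := (sigma / Num.sqrt w)%R.
have tau0 : tau != 0%R by rewrite gt_eqF// divr_gt0.
rewrite ge0_integral_normal; first last.
- by move=> x; rewrite lee_fin expR_ge0.
- apply/measurable_EFinP/measurableT_comp => //.
  by apply: measurable_funM => //; exact: measurable_funX.
transitivity (\int[leb]_x (((Num.sqrt w)^-1)%:E * (normal_pdf 0 tau x)%:E)).
  apply: eq_integral => x _; rewrite -!EFinM !normal_pdfE//; congr EFin.
  rewrite mulrCA [RHS]mulrA /normal_fun -expRD; congr (_ * expR _)%R.
    rewrite /normal_peak /tau expr_div_n sqr_sqrtr ?ltW//.
    have -> : (sigma ^+ 2 / w * pi *+ 2 = (sigma ^+ 2 * pi *+ 2) / w)%R.
      by field; rewrite gt_eqF.
    rewrite sqrtrM ?sqrtrV ?ltW//; last first.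
      by rewrite pmulrn_lgt0// mulr_gt0 ?pi_gt0// exprn_gt0.
    by rewrite invfM invrK mulrCA mulVf ?mulr1 ?gt_eqF.
  rewrite /tau expr_div_n sqr_sqrtr ?ltW//.
  by rewrite (@rescale_square c x w)// gt_eqF.
rewrite ge0_integralZl//; last 2 first.
- by apply/measurable_EFinP; exact: measurable_normal_pdf.
- by move=> x _; rewrite lee_fin normal_pdf_ge0.
by rewrite integral_normal_pdf mule1.
Qed.

End normal.

Section vector_algebra.
Context {R : realType} {d : nat}.
Implicit Types (x y z : d.-tuple R) (c : R).

Definition vec_scale c x : d.-tuple R := [tuple c * tnth x i | i < d].

Definition sqr_dist x y : R := vec_dot (vec_sub x y) (vec_sub x y).

Lemma vec_dotC x y : vec_dot x y = vec_dot y x.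
Proof. by apply: eq_bigr => i _; rewrite mulrC. Qed.

Lemma vec_dotZl c x y : vec_dot (vec_scale c x) y = c * vec_dot x y.
Proof.
rewrite /vec_dot mulr_sumr; apply: eq_bigr => i _.
by rewrite tnth_mktuple mulrA.
Qed.

Lemma vec_dotZr c x y : vec_dot x (vec_scale c y) = c * vec_dot x y.
Proof. by rewrite vec_dotC vec_dotZl vec_dotC. Qed.

Lemma vec_dotBl x y z : vec_dot (vec_sub x y) z = vec_dot x z - vec_dot y z.
Proof.
rewrite /vec_dot -sumrB; apply: eq_bigr => i _.
by rewrite tnth_mktuple mulrBl.
Qed.

Lemma vec_dotBr x y z : vec_dot z (vec_sub x y) = vec_dot z x - vec_dot z y.
Proof. by rewrite ![vec_dot z _]vec_dotC vec_dotBl. Qed.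

Lemma vec_dot_ge0 x : 0 <= vec_dot x x.
Proof. by apply: sumr_ge0 => i _; rewrite -expr2 sqr_ge0. Qed.

Lemma sqr_vec_norm x : vec_norm x ^+ 2 = vec_dot x x.
Proof. by rewrite sqr_sqrtr// vec_dot_ge0. Qed.

Lemma measurable_vec_dot d' (T : measurableType d') (f g : T -> d.-tuple R) :
  measurable_fun setT f -> measurable_fun setT g ->
  measurable_fun setT (fun t => vec_dot (f t) (g t)).
Proof.
move=> mf mg; apply: measurable_sum => i.
by apply: measurable_funM; apply: (measurableT_comp (measurable_tnth i)).
Qed.

End vector_algebra.

Section vector_cons.
Context {R : realType} {d : nat}.
Implicit Types (x y : d.-tuple R) (a b : R).

Lemma vec_dot_cons a b x y :
  vec_dot [tuple of a :: x] [tuple of b :: y] = a * b + vec_dot x y.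
Proof.
rewrite /vec_dot big_ord_recl !tnth0; congr (_ + _).
by apply: eq_bigr => i _; rewrite !tnthS.
Qed.

Lemma vec_add_cons a b x y :
  vec_add [tuple of a :: x] [tuple of b :: y] = [tuple of a + b :: vec_add x y].
Proof.
apply: eq_from_tnth => i; rewrite tnth_mktuple.
by case: (unliftP ord0 i) => [j|] ->; rewrite ?tnth0 ?tnthS ?tnth_mktuple.
Qed.

End vector_cons.

Section power_integral.
Local Open Scope ereal_scope.
Context {d} {T : measurableType d} {R : realType}.
Variable P : probability T R.

Lemma ge0_integral_prod_prob {d'} {U : measurableType d'} (Q : probability U R)
    (f : T * U -> \bar R) :
  measurable_fun setT f -> (forall x, 0 <= f x) ->
  \int[prod_prob P Q]_x f x = \int[P]_x \int[Q]_y f (x, y).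
Proof. by move=> mf f0; rewrite -(fubini_tonelli1 f). Qed.

Lemma ge0_integral_power_prob0 (f : 0.-tuple T -> \bar R) :
  (forall x, 0 <= f x) -> \int[power_prob P 0]_s f s = f [tuple].
Proof.
move=> f0; rewrite /power_prob (_ : f = cst (f [tuple])); last first.
  by apply/funext => x; rewrite tuple0.
by rewrite (integral_dirac _ measurableT)// diracT mul1e.
Qed.

Lemma ge0_integral_power_probS n (f : n.+1.-tuple T -> \bar R) :
  measurable_fun setT f -> (forall x, 0 <= f x) ->
  \int[power_prob P n.+1]_s f s =
  \int[P]_x \int[power_prob P n]_s f [tuple of x :: s].
Proof.
move=> mf f0; rewrite [LHS]ge0_integral_distribution//.
rewrite ge0_integral_prod_prob//.
  by apply: measurableT_comp => //; exact: measurable_tuple_cons.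
by move=> x; exact: f0.
Qed.

Lemma measurable_fun_power_probS n (f : n.+1.-tuple T -> \bar R) x :
  measurable_fun setT f ->
  measurable_fun setT (fun s : n.-tuple T => f [tuple of x :: s]).
Proof.
move=> mf; apply: (measurableT_comp mf).
exact: measurable_cons.
Qed.

End power_integral.

Section gaussian.
Local Open Scope ereal_scope.
Context {R : realType}.
Variable sigma : R.
Hypothesis sigma_gt0 : (0 < sigma)%R.

(** The density of N(s, sigma^2 I_d) with respect to N(0, sigma^2 I_d). *)
Definition tilt {d} (s y : d.-tuple R) : R :=
  expR ((vec_dot s y - vec_dot s s / 2) / sigma ^+ 2).

Lemma tilt_gt0 {d} (s y : d.-tuple R) : (0 < tilt s y)%R.
Proof. exact: expR_gt0. Qed.

Lemma tilt_ge0 {d} (s y : d.-tuple R) : (0 <= tilt s y)%R.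
Proof. exact: expR_ge0. Qed.

Lemma tilt_cons {d} a b (s y : d.-tuple R) :
  tilt [tuple of a :: s] [tuple of b :: y] = (tilt1 sigma a b * tilt s y)%R.
Proof.
have s0 : sigma != 0%R by rewrite gt_eqF.
by rewrite /tilt /tilt1 !vec_dot_cons -expRD; congr expR; field.
Qed.

Lemma measurable_tilt {d} d' (T : measurableType d') (f g : T -> d.-tuple R) :
  measurable_fun setT f -> measurable_fun setT g ->
  measurable_fun setT (fun t => tilt (f t) (g t)).
Proof.
move=> mf mg; apply: measurableT_comp => //; apply: measurable_funM => //.
apply: measurable_funB; first exact: measurable_vec_dot.
by apply: measurable_funM => //; exact: measurable_vec_dot.
Qed.

(** The Cameron-Martin formula: coordinate by coordinate, both the measure and
    the density factor, so the one-dimensional formula [normal_shift] and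
    Tonelli's theorem suffice. *)
Lemma gaussian_shift {d} (s : d.-tuple R) (f : d.-tuple R -> \bar R) :
  measurable_fun setT f -> (forall x, 0 <= f x) ->
  \int[gaussian sigma]_z f (vec_add s z) =
  \int[gaussian sigma]_y (f y * (tilt s y)%:E).
Proof.
have madd m (t : m.-tuple R) : measurable_fun setT (vec_add t).
  exact: (measurableT_comp measurable_vec_add_pair (pair1_measurable t)).
elim: d s f => [s f _ f0|d IH s' f mf f0].
  rewrite /gaussian !ge0_integral_power_prob0//; last first.
    by move=> x; rewrite mule_ge0// lee_fin tilt_ge0.
  rewrite (tuple0 (vec_add _ _)) /tilt /vec_dot !big_ord0.
  by rewrite mul0r subrr mul0r expR0 mule1.
have [a s] := tupleP s'.
have mft t : measurable_fun setT (fun y => f y * (tilt t y)%:E).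
  by apply: emeasurable_funM => //; apply/measurable_EFinP/measurable_tilt.
have ft0 t y : 0 <= f y * (tilt t y)%:E by rewrite mule_ge0// lee_fin tilt_ge0.
rewrite /gaussian !ge0_integral_power_probS//; last first.
  exact: (measurableT_comp mf (madd _ _)).
rewrite -/(gaussian sigma).
under eq_integral => b _.
  under eq_integral => z _ do rewrite vec_add_cons.
  rewrite (IH s (fun y => f [tuple of (a + b)%R :: y]))//; last first.
    exact: measurable_fun_power_probS.
  over.
under [RHS]eq_integral => b _.
  under eq_integral => y _ do rewrite tilt_cons EFinM muleCA.
  rewrite ge0_integralZl//; last 3 first.
  - apply: emeasurable_funM; first exact: measurable_fun_power_probS.
    by apply/measurable_EFinP/measurable_tilt.
  - by move=> y _; rewrite mule_ge0// lee_fin tilt_ge0.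
  - by rewrite lee_fin expR_ge0.
  rewrite muleC.
  over.
rewrite (normal_shift sigma_gt0 a (f := fun c =>
  \int[gaussian sigma]_y (f [tuple of c :: y] * (tilt s y)%:E)))//.
- apply: (measurable_fun_fubini_tonelli_F (m2 := gaussian sigma)
    (fun p => f [tuple of p.1 :: p.2] * (tilt s p.2)%:E)).
    apply: emeasurable_funM.
      by apply: (measurableT_comp mf); exact: measurable_tuple_cons.
    by apply/measurable_EFinP/measurable_tilt.
  by move=> x; rewrite mule_ge0// lee_fin tilt_ge0.
- by move=> c; apply: integral_ge0 => y _; rewrite mule_ge0// lee_fin tilt_ge0.
Qed.

Lemma integral_gaussian_tilt {d} (s : d.-tuple R) :
  \int[gaussian sigma]_y (tilt s y)%:E = 1.
Proof.
have := @gaussian_shift d s (cst 1) (measurable_cst _) (fun=> lee01).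
rewrite integral_cst// [X in _ * X]probability_setT mule1 => ->.
by apply: eq_integral => y _; rewrite mul1e.
Qed.

(** The Laplace transform of G, read off from the total mass of [tilt] at the
    centre s = sigma^2 a. *)
Lemma integral_gaussian_expR_dot {d} (a : d.-tuple R) :
  \int[gaussian sigma]_y (expR (vec_dot a y))%:E =
  (expR (sigma ^+ 2 * vec_dot a a / 2))%:E.
Proof.
have s0 : sigma != 0%R by rewrite gt_eqF.
rewrite -[RHS]mule1 -(integral_gaussian_tilt (vec_scale (sigma ^+ 2) a)).
rewrite -ge0_integralZl//; last 2 first.
- by apply/measurable_EFinP/measurable_tilt.
- by move=> y _; rewrite lee_fin tilt_ge0.
apply: eq_integral => y _; rewrite -EFinM /tilt -expRD; congr (expR _)%:E.
by rewrite !(vec_dotZl, vec_dotZr); field.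
Qed.

Lemma integral_gaussian_expR_sqr {d} (c : R) : (2 * c * sigma ^+ 2 < 1)%R ->
  \int[@gaussian R d sigma]_x (expR (c * vec_dot x x))%:E =
  ((Num.sqrt (1 - 2 * c * sigma ^+ 2))^-1 ^+ d)%:E.
Proof.
move=> hc; elim: d => [|d IH]; rewrite /gaussian.
  by rewrite ge0_integral_power_prob0 ?/vec_dot ?big_ord0 ?mulr0 ?expR0// => x;
    rewrite lee_fin expR_ge0.
have mdot m : measurable_fun setT
    (fun x : m.-tuple R => (expR (c * vec_dot x x))%:E).
  apply/measurable_EFinP/measurableT_comp => //; apply: measurable_funM => //.
  exact: measurable_vec_dot.
rewrite ge0_integral_power_probS//.
rewrite -/(gaussian sigma).
under eq_integral => a _.
  under eq_integral => x _ do rewrite vec_dot_cons mulrDr expRD EFinM.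
  rewrite ge0_integralZl//; last exact: mdot.
  rewrite IH -expr2 muleC; over.
rewrite ge0_integralZl//; last first.
  apply/measurable_EFinP; apply: measurableT_comp => //.
  by apply: measurable_funM.
by rewrite integral_normal_expR_sqr// -EFinM (exprSr _ d).
Qed.

End gaussian.

(** * Averages of independent variables of mean one *)

Section empirical_second_moment.
Local Open Scope ereal_scope.
Context {d} {T : measurableType d} {R : realType}.
Variable P : probability T R.

Definition tuple_sum n (h : T -> R) (s : n.-tuple T) : R :=
  (\sum_(i < n) h (tnth s i))%R.

Lemma tuple_sum_cons n h x (s : n.-tuple T) :
  tuple_sum h [tuple of x :: s] = (h x + tuple_sum h s)%R.
Proof.
rewrite /tuple_sum big_ord_recl tnth0; congr (_ + _)%R.
by apply: eq_bigr => i _; rewrite tnthS.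
Qed.

Lemma measurable_tuple_sum n h : measurable_fun setT h ->
  measurable_fun setT (@tuple_sum n h).
Proof.
move=> mh; apply: measurable_sum => i.
exact: (measurableT_comp mh (measurable_tnth i)).
Qed.

Variable h : T -> R.
Hypothesis mh : measurable_fun setT h.
Hypothesis h0 : forall x, (0 <= h x)%R.
Hypothesis h1 : \int[P]_x (h x)%:E = 1.

Let tuple_sum_ge0 n (s : n.-tuple T) : (0 <= tuple_sum h s)%R.
Proof. by apply: sumr_ge0. Qed.

#[local] Hint Resolve tuple_sum_ge0 : core.

Let mh' : measurable_fun setT (fun x => (h x)%:E).
Proof. exact/measurable_EFinP. Qed.

Let msum n : measurable_fun setT (fun s : n.-tuple T => (tuple_sum h s)%:E).
Proof. by apply/measurable_EFinP; exact: measurable_tuple_sum. Qed.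

Let power_cst n (c : R) : \int[power_prob P n]_s c%:E = c%:E.
Proof. by rewrite integral_cst// [X in _ * X]probability_setT mule1. Qed.

Let prob_cst (c : R) : \int[P]_s c%:E = c%:E.
Proof. by rewrite integral_cst// [X in _ * X]probability_setT mule1. Qed.

Lemma integral_tuple_sum n :
  \int[power_prob P n]_s (tuple_sum h s)%:E = n%:R%:E.
Proof.
elim: n => [|n IH].
  rewrite ge0_integral_power_prob0; last by move=> s; rewrite lee_fin.
  by rewrite /tuple_sum big_ord0.
rewrite ge0_integral_power_probS//; last by move=> s; rewrite lee_fin.
under eq_integral => x _.
  under eq_integral => s _ do rewrite tuple_sum_cons EFinD.
  rewrite ge0_integralD//; last 3 first.
  - by move=> s _; rewrite lee_fin.
  - by move=> s _; rewrite lee_fin.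
  - exact: msum.
  rewrite power_cst IH; over.
rewrite ge0_integralD//; last by move=> x _; rewrite lee_fin.
by rewrite prob_cst h1 -EFinD -natr1 addrC.
Qed.

(** The n diagonal terms contribute E h^2 each and the n (n - 1) off-diagonal
    ones (E h)^2 = 1 each.  With h >= 0 the induction on n only needs Tonelli's
    theorem, and E h^2 may be infinite. *)
Lemma integral_sqr_tuple_sum n :
  \int[power_prob P n]_s (tuple_sum h s ^+ 2)%:E =
  n%:R%:E * \int[P]_x (h x ^+ 2)%:E + (n%:R * (n%:R - 1))%:E.
Proof.
have msq m : measurable_fun setT
    (fun s : m.-tuple T => (tuple_sum h s ^+ 2)%:E).
  apply/measurable_EFinP; apply: measurable_funX; exact: measurable_tuple_sum.
have mhsq : measurable_fun setT (fun x => (h x ^+ 2)%:E).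
  exact/measurable_EFinP/measurable_funX.
have I0 : 0 <= \int[P]_x (h x ^+ 2)%:E.
  by apply: integral_ge0 => x _; rewrite lee_fin sqr_ge0.
elim: n => [|n IH].
  rewrite ge0_integral_power_prob0; last by move=> x; rewrite lee_fin sqr_ge0.
  by rewrite /tuple_sum big_ord0 expr0n mul0e mul0r adde0.
rewrite ge0_integral_power_probS//; last by move=> x; rewrite lee_fin sqr_ge0.
have n1 : (0 <= n%:R * (n%:R - 1) :> R)%R.
  case: n {IH} => [|n]; first by rewrite mul0r.
  by rewrite mulr_ge0// subr_ge0 ler1n.
set M := \int[power_prob P n]_s (tuple_sum h s ^+ 2)%:E in IH *.
have M0 : 0 <= M by apply: integral_ge0 => x _; rewrite lee_fin sqr_ge0.
have expand x (s : n.-tuple T) : (tuple_sum h [tuple of x :: s] ^+ 2)%:E =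
    (h x ^+ 2)%:E +
    ((2 * h x)%:E * (tuple_sum h s)%:E + (tuple_sum h s ^+ 2)%:E).
  by rewrite tuple_sum_cons -EFinM -!EFinD; congr EFin; ring.
have h2 x : 0 <= (2 * h x)%:E by rewrite lee_fin mulr_ge0.
have cross0 x (s : n.-tuple T) : 0 <= (2 * h x)%:E * (tuple_sum h s)%:E.
  by rewrite mule_ge0// lee_fin.
have sq0 (x : R) : 0 <= (x ^+ 2)%:E by rewrite lee_fin sqr_ge0.
have inner x : \int[power_prob P n]_s (tuple_sum h [tuple of x :: s] ^+ 2)%:E =
    (h x ^+ 2)%:E + ((n%:R * 2)%:E * (h x)%:E + M).
  under eq_integral => s _ do rewrite expand.
  rewrite ge0_integralD//; last 2 first.
  - by move=> s _; rewrite adde_ge0.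
  - apply: emeasurable_funD; last exact: msq.
    by apply: measurable_funeM; exact: msum.
  rewrite power_cst ge0_integralD//; last 2 first.
  - by apply: measurable_funeM; exact: msum.
  - exact: msq.
  rewrite ge0_integralZl//; last 2 first.
  - exact: msum.
  - by move=> s _; rewrite lee_fin.
  rewrite integral_tuple_sum -/M -!EFinM; congr (_ + (_%:E + _)); ring.
clearbody M; under eq_integral => x _ do rewrite inner.
have n2 : 0 <= (n%:R * 2 : R)%:E by rewrite lee_fin mulr_ge0.
have lin0 x : 0 <= (n%:R * 2)%:E * (h x)%:E by rewrite mule_ge0// lee_fin.
rewrite ge0_integralD//; last 2 first.
- by move=> x _; rewrite adde_ge0.
- by apply: emeasurable_funD => //; exact: measurable_funeM.
rewrite ge0_integralD//; last exact: measurable_funeM.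
rewrite ge0_integralZl//; last by move=> x _; rewrite lee_fin.
rewrite h1 mule1 integral_cst// [X in M * X]probability_setT mule1 IH.
rewrite -[in RHS]natr1 EFinD ge0_muleDl// ?mul1e ?lee_fin//.
have -> : ((n%:R + 1) * (n%:R + 1 - 1))%:E =
    (n%:R * 2)%:E + (n%:R * (n%:R - 1))%:E :> \bar R.
  by rewrite -EFinD; congr EFin; ring.
move: (\int[P]_x (h x ^+ 2)%:E) => I.
by rewrite (addeCA (n%:R * 2)%:E) addeA (addeC I).
Qed.

End empirical_second_moment.

Section empirical_deviation.
Local Open Scope ereal_scope.
Context {d1 d2} {T : measurableType d1} {U : measurableType d2} {R : realType}.
Variables (P : probability T R) (nu : {finite_measure set U -> \bar R}).
Variable r : T -> U -> R.
Hypothesis mr : measurable_fun setT (fun p : T * U => r p.1 p.2).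
Hypothesis r0 : forall x y, (0 <= r x y)%R.
Hypothesis nu1 : nu setT = 1.
Hypothesis rP : forall y, \int[P]_x (r x y)%:E = 1.
Hypothesis rnu : forall x, \int[nu]_y (r x y)%:E = 1.

Definition empirical_mean n (s : n.-tuple T) (y : U) : R :=
  (n%:R^-1 * tuple_sum (r ^~ y) s)%R.

Let mr1 y : measurable_fun setT (r ^~ y).
Proof. exact: (measurableT_comp mr (pair2_measurable y)). Qed.

Let mr2 x : measurable_fun setT (r x).
Proof. exact: (measurableT_comp mr (pair1_measurable x)). Qed.

Lemma empirical_mean_ge0 n (s : n.-tuple T) y : (0 <= empirical_mean s y)%R.
Proof. by rewrite mulr_ge0 ?invr_ge0// sumr_ge0. Qed.

Lemma measurable_empirical_mean n (s : n.-tuple T) :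
  measurable_fun setT (empirical_mean s).
Proof. by apply: measurable_funM => //; exact: measurable_sum. Qed.

Lemma measurable_empirical_mean2 n :
  measurable_fun setT (fun p : n.-tuple T * U => empirical_mean p.1 p.2).
Proof.
apply: measurable_funM => //; apply: measurable_sum => i.
have mpair : measurable_fun setT (fun p : n.-tuple T * U => (tnth p.1 i, p.2)).
  apply: measurable_fun_pair => //.
  exact: (measurableT_comp (measurable_tnth i) measurable_fst).
exact: (measurableT_comp mr mpair).
Qed.

Lemma integral_empirical_mean n (s : n.-tuple T) : (0 < n)%N ->
  \int[nu]_y (empirical_mean s y)%:E = 1.
Proof.
move=> n0; rewrite /empirical_mean /tuple_sum.
under eq_integral => y _ do rewrite EFinM -sumEFin.
rewrite ge0_integralZl//; last 2 first.
- by apply: emeasurable_sum => i; exact/measurable_EFinP.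
- by move=> y _; apply: sume_ge0 => i _; rewrite lee_fin.
rewrite ge0_integral_sum//; last 2 first.
- by move=> i; exact/measurable_EFinP.
- by move=> i y _; rewrite lee_fin.
rewrite (eq_bigr (fun=> 1)) => [|i _]; last exact: rnu.
rewrite (sumEFin _ xpredT (fun=> 1%R)) sumr_const card_ord -EFinM.
by rewrite mulVf// pnatr_eq0 -lt0n.
Qed.

Lemma integral_sqr_empirical_mean n (y : U) : (0 < n)%N ->
  \int[power_prob P n]_s (empirical_mean s y ^+ 2)%:E =
  n%:R^-1%:E * \int[P]_x (r x y ^+ 2)%:E + (1 - n%:R^-1)%:E.
Proof.
move=> n0; rewrite /empirical_mean.
under eq_integral => s _ do rewrite exprMn EFinM.
rewrite ge0_integralZl//; last 2 first.
- apply/measurable_EFinP; apply: measurable_funX; exact: measurable_tuple_sum.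
- by move=> s _; rewrite lee_fin sqr_ge0.
have n0' : (n%:R != 0 :> R)%R by rewrite pnatr_eq0 -lt0n.
have n1 : (0 <= n%:R * (n%:R - 1) :> R)%R.
  by rewrite mulr_ge0// subr_ge0 ler1n.
have I0 : 0 <= \int[P]_x (r x y ^+ 2)%:E.
  by apply: integral_ge0 => x _; rewrite lee_fin sqr_ge0.
rewrite integral_sqr_tuple_sum// ge0_muleDr ?mule_ge0//.
by rewrite muleA -!EFinM; congr (_%:E * _ + _%:E); field.
Qed.

(** For fixed y the average of n independent copies of r(S, y) has variance
    1/n times that of r(S, y); Tonelli's theorem moves this inside the integral
    over y.  The computation is done on second moments, which stay nonnegative,
    and [integral_sqr_dev] converts to and from variances at both ends. *)
Lemma integral_sqr_dev_empirical_mean n : (0 < n)%N ->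
  \int[power_prob P n]_s \int[nu]_y ((empirical_mean s y - 1) ^+ 2)%:E =
  n%:R^-1%:E * \int[P]_x \int[nu]_y ((r x y - 1) ^+ 2)%:E.
Proof.
move=> n0.
have n1 : (0 <= 1 - n%:R^-1 :> R)%R.
  by rewrite subr_ge0 invf_le1 ?ler1n ?ltr0n.
have msq : measurable_fun setT (fun p : T * U => (r p.1 p.2 ^+ 2)%:E).
  exact/measurable_EFinP/measurable_funX.
have mdev : measurable_fun setT (fun p : T * U => ((r p.1 p.2 - 1) ^+ 2)%:E).
  exact/measurable_EFinP/measurable_funX/measurable_funB.
have memp := @measurable_empirical_mean2 n.
have mesq : measurable_fun setT
    (fun p : n.-tuple T * U => (empirical_mean p.1 p.2 ^+ 2)%:E).
  exact/measurable_EFinP/measurable_funX.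
have medev : measurable_fun setT
    (fun p : n.-tuple T * U => ((empirical_mean p.1 p.2 - 1) ^+ 2)%:E).
  exact/measurable_EFinP/measurable_funX/measurable_funB.
have J : \int[P]_x \int[nu]_y ((r x y - 1) ^+ 2)%:E + 1 =
         \int[P]_x \int[nu]_y (r x y ^+ 2)%:E.
  under [RHS]eq_integral => x _ do rewrite -integral_sqr_dev//.
  rewrite [RHS]ge0_integralD//; last 2 first.
  - by move=> x _; apply: integral_ge0 => y _; rewrite lee_fin sqr_ge0.
  - apply: (measurable_fun_fubini_tonelli_F (m2 := nu) _ mdev).
    by move=> p; rewrite lee_fin sqr_ge0.
  by rewrite integral_cst// [X in _ * X]probability_setT mule1.
have E :
    \int[power_prob P n]_s \int[nu]_y ((empirical_mean s y - 1) ^+ 2)%:E + 1 =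
    \int[power_prob P n]_s \int[nu]_y (empirical_mean s y ^+ 2)%:E.
  under [RHS]eq_integral => s _.
    rewrite -integral_sqr_dev//; last 3 first.
    + exact: measurable_empirical_mean.
    + by move=> y; exact: empirical_mean_ge0.
    + exact: integral_empirical_mean.
    over.
  rewrite [RHS]ge0_integralD//; last 2 first.
  - by move=> x _; apply: integral_ge0 => y _; rewrite lee_fin sqr_ge0.
  - apply: (measurable_fun_fubini_tonelli_F (m2 := nu) _ medev).
    by move=> p; rewrite lee_fin sqr_ge0.
  by rewrite integral_cst// [X in _ * X]probability_setT mule1.
(* Adding 1 to both sides turns variances into second moments. *)
apply: (@can_inj _ _ (fun z : \bar R => z + 1) (fun z => z - 1)).
  by move=> z; rewrite addeK.
rewrite E (fubini_tonelli _ mesq); last by move=> p; rewrite lee_fin sqr_ge0.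
under eq_integral => y _ do rewrite integral_sqr_empirical_mean//.
rewrite ge0_integralD//; last 2 first.
- move=> y _; rewrite mule_ge0 ?lee_fin ?invr_ge0// integral_ge0// => x _.
  by rewrite lee_fin sqr_ge0.
- apply: measurable_funeM.
  apply: (measurable_fun_fubini_tonelli_G (m1 := P) _ msq).
  by move=> p; rewrite lee_fin sqr_ge0.
rewrite ge0_integralZl//; last 2 first.
- apply: (measurable_fun_fubini_tonelli_G (m1 := P) _ msq).
  by move=> p; rewrite lee_fin sqr_ge0.
- by move=> y _; apply: integral_ge0 => x _; rewrite lee_fin sqr_ge0.
rewrite integral_cst// [X in _ + _ * X]nu1 mule1.
rewrite -(fubini_tonelli _ msq); last by move=> p; rewrite lee_fin sqr_ge0.
rewrite -J ge0_muleDr//; last first.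
  apply: integral_ge0 => x _; apply: integral_ge0 => y _.
  by rewrite lee_fin sqr_ge0.
rewrite mule1 -addeA; congr (_ + _); rewrite -EFinD; congr EFin; ring.
Qed.

End empirical_deviation.

(** * Gaussian mixtures and their densities *)

Section empirical_integral.
Local Open Scope ereal_scope.
Context {d} {T : measurableType d} {R : realType}.

Lemma ge0_integral_empirical n (s : n.-tuple T) (f : T -> \bar R) : (0 < n)%N ->
  measurable_fun setT f -> (forall x, 0 <= f x) ->
  \int[empirical s]_x f x = n%:R^-1%:E * \sum_(i < n) f (tnth s i).
Proof.
case: n s => // n s _ mf f0.
have c0 : (0 <= n.+1%:R^-1 :> R)%R by rewrite invr_ge0.
(* [inord] indexes the Dirac masses by nat, as [msum] requires. *)
pose m_ k : {measure set T -> \bar R} := \d_(tnth s (inord k)).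
rewrite (eq_measure_integral (mscale (NngNum c0) (msum m_ n.+1))); last first.
  move=> A mA _; rewrite /empirical /mscale/= /msum; congr (_ * _).
  by apply: eq_bigr => i _; rewrite /m_ inord_val.
rewrite ge0_integral_mscale// ge0_integral_measure_sum//; congr (_ * _).
apply: eq_bigr => i _; rewrite /m_ inord_val.
by rewrite integral_dirac// diracT mul1e.
Qed.

End empirical_integral.

Section gaussian_mixture.
Local Open Scope ereal_scope.
Context {R : realType} {d : nat}.
Variable sigma : R.
Hypothesis sigma_gt0 : (0 < sigma)%R.
Local Notation V := (d.-tuple R).
Local Notation G := (@gaussian R d sigma).

Let measurable_tilt_pair :
  measurable_fun setT (fun p : V * V => tilt sigma p.1 p.2).
Proof. exact: measurable_tilt. Qed.

Let measurable_tilt_l y : measurable_fun setT (tilt sigma ^~ y : V -> R).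
Proof. exact: measurable_tilt. Qed.

Let measurable_tilt_r s : measurable_fun setT (tilt sigma s : V -> R).
Proof. exact: measurable_tilt. Qed.

(** The law of (s, s + z) for s of law mu and z Gaussian, with density
    e_s(y) with respect to the product of mu and G.  It yields both the density
    of a convolution and that of the joint law of a signal and its noisy
    observation. *)
Lemma ge0_integral_prod_gaussian_shift (mu : {finite_measure set V -> \bar R})
    (F : V * V -> \bar R) :
  measurable_fun setT F -> (forall p, 0 <= F p) ->
  \int[(mu \x G)%E]_p F (p.1, vec_add p.1 p.2) =
  \int[mu]_s \int[G]_y (F (s, y) * (tilt sigma s y)%:E).
Proof.
move=> mF F0.
have mshift : measurable_fun setT (fun p : V * V => (p.1, vec_add p.1 p.2)).
  by apply: measurable_fun_pair => //; exact: measurable_vec_add_pair.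
rewrite (fubini_tonelli1 (fun p => F (p.1, vec_add p.1 p.2)))//; last first.
  exact: (measurableT_comp mF mshift).
apply: eq_integral => s _; rewrite /fubini_F/=.
rewrite (gaussian_shift sigma_gt0 s (f := fun y => F (s, y)))//.
exact: (measurableT_comp mF (pair1_measurable s)).
Qed.

Lemma convolution_gaussianE (mu : {finite_measure set V -> \bar R})
    (A : set V) :
  measurable A ->
  convolution mu G A = \int[G]_(y in A) \int[mu]_s (tilt sigma s y)%:E.
Proof.
move=> mA.
have mF : measurable_fun setT (fun p : V * V => (\1_A p.2)%:E : \bar R).
  apply/measurable_EFinP; apply: (measurableT_comp _ measurable_snd).
  exact: measurable_indic.
have := @ge0_integral_prod_gaussian_shift mu _ mF
  (fun p => ltac:(by rewrite lee_fin)).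
rewrite (_ : \int[_]_p _ = convolution mu G A); last first.
  rewrite /convolution /pushforward -[vec_add_pair @^-1` A]setIT.
  rewrite -integral_indic//.
  rewrite -[X in measurable X]setTI.
  exact: measurable_vec_add_pair.
move=> ->.
rewrite (fubini_tonelli
  (fun p => (\1_A p.2)%:E * (tilt sigma p.1 p.2)%:E))//; last 2 first.
- by apply: emeasurable_funM => //; exact/measurable_EFinP.
- by move=> p; rewrite -EFinM lee_fin mulr_ge0// tilt_ge0.
rewrite [RHS]integral_mkcond; apply: eq_integral => y _ /=.
rewrite ge0_integralZl//; last 2 first.
- exact/measurable_EFinP.
- by move=> s _; rewrite lee_fin tilt_ge0.
by rewrite patchE indicE; case: ifP => _; rewrite ?mul1e ?mul0e.
Qed.

Section mixture.
Variable P : probability V R.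
Local Notation nu := (convolution P G).

(** The density of P * G with respect to G.  It is finite because, for fixed y,
    e_s(y) is at most exp (|y|^2 / (2 sigma^2)), its value at s = y. *)
Definition mixture (y : V) : R := fine (\int[P]_s (tilt sigma s y)%:E).

Let tilt_le (s y : V) :
  (tilt sigma s y <= expR (vec_dot y y / 2 / sigma ^+ 2))%R.
Proof.
rewrite /tilt ler_expR ler_pM2r ?invr_gt0 ?exprn_gt0// lerBlDr.
have := vec_dot_ge0 (vec_sub s y).
by rewrite vec_dotBl !vec_dotBr (vec_dotC y s); lra.
Qed.

Lemma mixtureE y : \int[P]_s (tilt sigma s y)%:E = (mixture y)%:E.
Proof.
rewrite fineK// fin_numElt; apply/andP; split.
  rewrite (lt_le_trans (ltNyr 0))// integral_ge0// => s _.
  by rewrite lee_fin tilt_ge0.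
apply: (@le_lt_trans _ _ (\int[P]_s (expR (vec_dot y y / 2 / sigma ^+ 2))%:E)).
  apply: ge0_le_integral => //.
  - by move=> s _; rewrite lee_fin tilt_ge0.
  - exact/measurable_EFinP.
  - by move=> s _; rewrite lee_fin.
by rewrite integral_cst// [X in _ * X]probability_setT mule1 ltry.
Qed.

Lemma mixture_gt0 y : (0 < mixture y)%R.
Proof.
rewrite -lte_fin -mixtureE lt0e; apply/andP; split; last first.
  by apply: integral_ge0 => s _; rewrite lee_fin tilt_ge0.
apply/negP => /eqP P0.
have mt : measurable_fun setT (fun s => (tilt sigma s y)%:E).
  exact/measurable_EFinP.
have /ae_eq_integral_abs : \int[P]_s `|(tilt sigma s y)%:E| = 0.
  rewrite -[RHS]P0; apply: eq_integral => s _.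
  by rewrite gee0_abs// lee_fin tilt_ge0.
move=> /(_ measurableT mt) [N [mN N0 sub]].
have : P setT = 0.
  apply: (subset_measure0 measurableT mN _ N0) => s _; apply: sub => /= /(_ I).
  by move=> [] /eqP; rewrite gt_eqF// tilt_gt0.
by move/eqP; rewrite [X in X == _]probability_setT onee_eq0.
Qed.

Lemma measurable_mixture : measurable_fun setT mixture.
Proof.
apply/measurable_EFinP.
rewrite (_ : EFin \o _ = fun y => \int[P]_s (tilt sigma s y)%:E); last first.
  by apply/funext => y; rewrite /= mixtureE.
apply: (measurable_fun_fubini_tonelli_G (m1 := P)
  (fun p : V * V => (tilt sigma p.1 p.2)%:E)).
  exact/measurable_EFinP.
by move=> p; rewrite lee_fin tilt_ge0.
Qed.

Lemma has_density_mixture : has_density nu G mixture.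
Proof.
move=> A mA; transitivity (\int[G]_(y in A) \int[P]_s (tilt sigma s y)%:E).
  exact: convolution_gaussianE.
by apply: eq_integral => y _; rewrite mixtureE.
Qed.

Lemma ge0_integral_mixture (f : V -> \bar R) :
  measurable_fun setT f -> (forall y, 0 <= f y) ->
  \int[nu]_y f y = \int[G]_y (f y * (mixture y)%:E).
Proof.
move=> mf f0; apply: ge0_integral_density => //.
- exact: measurable_mixture.
- by move=> y; exact/ltW/mixture_gt0.
- exact: has_density_mixture.
Qed.

Lemma convolution_gaussian_setT (mu : {finite_measure set V -> \bar R}) :
  mu setT = 1 -> convolution mu G setT = 1.
Proof.
move=> mu1; change ((mu \x G) (vec_add_pair @^-1` setT) = 1).
rewrite preimage_setT -setXTT [LHS]product_measure1E//.
by rewrite [X in X * _]mu1 [X in _ * X]probability_setT mule1.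
Qed.

(** The density of N(s, sigma^2 I_d) with respect to P * G. *)
Definition likelihood_ratio (s y : V) : R := (tilt sigma s y / mixture y)%R.
Local Notation r := likelihood_ratio.

Lemma likelihood_ratio_gt0 s y : (0 < r s y)%R.
Proof. by rewrite divr_gt0 ?tilt_gt0 ?mixture_gt0. Qed.

Lemma measurable_likelihood_ratio :
  measurable_fun setT (fun p : V * V => r p.1 p.2).
Proof.
apply: measurable_funM => //.
apply: measurable_fun_inv_gt0; first by move=> p; exact: mixture_gt0.
exact: (measurableT_comp measurable_mixture measurable_snd).
Qed.

Lemma likelihood_ratio_mixture s y : (r s y * mixture y)%R = tilt sigma s y.
Proof. by rewrite divfK// gt_eqF// mixture_gt0. Qed.

Lemma integral_likelihood_ratio_l y : \int[P]_s (r s y)%:E = 1.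
Proof.
under eq_integral => s _ do rewrite /likelihood_ratio mulrC EFinM.
rewrite ge0_integralZl//; last 3 first.
- exact/measurable_EFinP.
- by move=> s _; rewrite lee_fin tilt_ge0.
- by rewrite lee_fin invr_ge0 ltW// mixture_gt0.
by rewrite mixtureE -EFinM mulVf// gt_eqF// mixture_gt0.
Qed.

Lemma integral_likelihood_ratio_r s : \int[nu]_y (r s y)%:E = 1.
Proof.
rewrite ge0_integral_mixture; last 2 first.
- apply/measurable_EFinP.
  exact: (measurableT_comp measurable_likelihood_ratio (pair1_measurable s)).
- by move=> y; rewrite lee_fin ltW// likelihood_ratio_gt0.
under eq_integral => y _ do rewrite -EFinM likelihood_ratio_mixture.
exact: integral_gaussian_tilt.
Qed.

End mixture.

End gaussian_mixture.

(** * The expected divergence and the chi-square information *)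

Section expected_KL_bound.
Local Open Scope ereal_scope.
Context {R : realType} {d : nat}.
Variable sigma : R.
Hypothesis sigma_gt0 : (0 < sigma)%R.
Variable P : probability (d.-tuple R) R.
Local Notation V := (d.-tuple R).
Local Notation G := (@gaussian R d sigma).
Local Notation nu := (convolution P G).
Local Notation q := (mixture sigma P).
Local Notation r := (likelihood_ratio sigma P).

Let r_ge0 s y : (0 <= r s y)%R.
Proof. exact/ltW/likelihood_ratio_gt0. Qed.

Let measurable_r_l y : measurable_fun setT (r ^~ y).
Proof.
exact: (measurableT_comp (measurable_likelihood_ratio sigma_gt0 P)
  (pair2_measurable y)).
Qed.

Let measurable_r_r s : measurable_fun setT (r s).
Proof.
exact: (measurableT_comp (measurable_likelihood_ratio sigma_gt0 P)
  (pair1_measurable s)).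
Qed.

Let measurable_r : measurable_fun setT (fun p : V * V => r p.1 p.2).
Proof. exact: measurable_likelihood_ratio. Qed.

Let nuT : nu setT = 1.
Proof. by apply: convolution_gaussian_setT; exact: probability_setT. Qed.

(** Stated for a general mu so as to apply to the empirical measure, whose rho
    is the average of the likelihood ratios at the sample points. *)
Lemma convolution_has_density (mu : {finite_measure set V -> \bar R})
    (rho : V -> R) :
  measurable_fun setT rho -> (forall y, (0 <= rho y)%R) ->
  (forall y, \int[mu]_s (r s y)%:E = (rho y)%:E) ->
  has_density (convolution mu G) nu rho.
Proof.
move=> mrho rho0 rhoE A mA.
transitivity (\int[G]_(y in A) \int[mu]_s (tilt sigma s y)%:E).
  exact: convolution_gaussianE.
rewrite [LHS]integral_mkcond [RHS]integral_mkcond.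
rewrite ge0_integral_mixture//; last 2 first.
- apply/(measurable_restrictT _ mA)/measurable_funTS.
  exact/measurable_EFinP.
- by move=> y; apply: erestrict_ge0 => z _; rewrite lee_fin.
apply: eq_integral => y _; rewrite !patchE; case: ifP => _.
  rewrite -rhoE; have q0 := mixture_gt0 sigma_gt0 P y.
  rewrite muleC -ge0_integralZl//; last 3 first.
  - exact/measurable_EFinP.
  - by move=> s _; rewrite lee_fin.
  - by rewrite lee_fin ltW.
  apply: eq_integral => s _.
  by rewrite -EFinM mulrC likelihood_ratio_mixture.
by rewrite mul0e.
Qed.

Lemma KL_empirical_le n (s : n.-tuple V) : (0 < n)%N ->
  KL (convolution (empirical s) G) nu <=
  \int[nu]_y ((empirical_mean r s y - 1) ^+ 2)%:E.
Proof.
move=> n0; have n0' : (n%:R != 0 :> R)%R by rewrite pnatr_eq0 -lt0n.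
have mr_l y : measurable_fun setT (fun t => (r t y)%:E).
  exact/measurable_EFinP.
apply: KL_le_sqr_dev.
- by apply: measurable_empirical_mean; exact: measurable_r.
- apply: convolution_has_density.
  + by apply: measurable_empirical_mean; exact: measurable_r.
  + by move=> y; apply: empirical_mean_ge0; exact: r_ge0.
  + move=> y; rewrite ge0_integral_empirical//.
      by rewrite sumEFin -EFinM.
    by move=> t; rewrite lee_fin.
- apply: convolution_gaussian_setT => //.
  transitivity (\int[empirical s]_x (cst 1 x : \bar R)).
    by rewrite integral_cst// mul1e.
  rewrite ge0_integral_empirical// /cst.
  rewrite (sumEFin _ xpredT (fun=> 1%R)) sumr_const card_ord -EFinM.
  by rewrite mulVf.
- exact: nuT.
- move=> y; rewrite mulr_gt0 ?invr_gt0 ?ltr0n//.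
  case: n s n0 n0' => // n s _ _.
  rewrite /tuple_sum big_ord_recl ltr_pwDl ?likelihood_ratio_gt0//.
  by apply: sumr_ge0 => i _; exact: r_ge0.
Qed.

Lemma expected_KL_le n : (0 < n)%N ->
  expected_KL P sigma n <=
  n%:R^-1%:E * \int[P]_s \int[nu]_y ((r s y - 1) ^+ 2)%:E.
Proof.
move=> n0; rewrite -integral_sqr_dev_empirical_mean//; last 2 first.
- by move=> y; exact: integral_likelihood_ratio_l.
- by move=> s; exact: integral_likelihood_ratio_r.
apply: le_integral_nonmeasurable => s; last exact: KL_empirical_le.
by apply: integral_ge0 => y _; rewrite lee_fin sqr_ge0.
Qed.

Section information.
Context {disp} {Omega : measurableType disp} (Pr : probability Omega R).
Variables S Z Y : {RV Pr >-> V}.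
Hypothesis hS : has_law S P.
Hypothesis hZ : has_law Z (gaussian sigma).
Hypothesis hSZ : independent_RV S Z.
Hypothesis hY : forall w, Y w = vec_add (S w) (Z w).

Lemma independent_law (A : set (V * V)) : measurable A ->
  distribution Pr (RV_pair S Z) A = (P \x G) A.
Proof.
move=> mA; apply/esym; apply: product_measure_unique => // B C mB mC.
transitivity (Pr (S @^-1` B `&` Z @^-1` C)) => //.
by rewrite hSZ//; congr (_ * _); [exact: hS|exact: hZ].
Qed.

Lemma sum_law (A : set V) : measurable A -> distribution Pr Y A = nu A.
Proof.
move=> mA.
transitivity (distribution Pr (RV_pair S Z) (vec_add_pair @^-1` A)).
  congr (Pr _); apply/seteqP; split => w /=; rewrite /vec_add_pair/= hY//.
rewrite independent_law// -[X in measurable X]setTI.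
exact: measurable_vec_add_pair.
Qed.

Lemma ge0_integral_marginals (f : V * V -> \bar R) :
  measurable_fun setT f -> (forall p, 0 <= f p) ->
  \int[prod_prob (distribution Pr S) (distribution Pr Y)]_p f p =
  \int[P]_s \int[nu]_y f (s, y).
Proof.
move=> mf f0; rewrite ge0_integral_prod_prob//.
rewrite (eq_measure_integral P); last by move=> A mA _; exact: hS.
apply: eq_integral => s _.
by apply: eq_measure_integral => A mA _; exact: sum_law.
Qed.

(** Conditionally on S = s the observation has law N(s, sigma^2 I_d), so the
    density of the joint law is that of this conditional law relative to the law
    P * G of Y. *)
Lemma joint_has_density :
  has_density (distribution Pr (RV_pair S Y))
    (prod_prob (distribution Pr S) (distribution Pr Y)) (fun p => r p.1 p.2).
Proof.
move=> A mA.
have m1A : measurable_fun setT (fun p : V * V => (\1_A p)%:E : \bar R).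
  by apply/measurable_EFinP; exact: measurable_indic.
have m1Ar : measurable_fun setT (fun p : V * V => (\1_A p * r p.1 p.2)%:E).
  by apply/measurable_EFinP; exact: measurable_funM.
have mshift : measurable_fun setT (fun p : V * V => (p.1, vec_add p.1 p.2)).
  by apply: measurable_fun_pair => //; exact: measurable_vec_add_pair.
have mA' : measurable ((fun p : V * V => (p.1, vec_add p.1 p.2)) @^-1` A).
  by rewrite -[X in measurable X]setTI; exact: mshift.
transitivity (\int[P \x G]_p (\1_A (p.1, vec_add p.1 p.2))%:E).
  transitivity ((P \x G) ((fun p : V * V => (p.1, vec_add p.1 p.2)) @^-1` A)).
    rewrite -independent_law//; congr (Pr _).
    by apply/seteqP; split => w /=; rewrite /RV_pair/= hY.
  by rewrite -[X in _ X = _]setIT -integral_indic.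
rewrite (ge0_integral_prod_gaussian_shift sigma_gt0 P
  (F := fun p => (\1_A p)%:E))//.
transitivity (\int[P]_s \int[nu]_y (\1_A (s, y) * r s y)%:E).
  apply: eq_integral => s _.
  rewrite [RHS]ge0_integral_mixture//; last 2 first.
  - exact: (measurableT_comp m1Ar (pair1_measurable s)).
  - by move=> y; rewrite lee_fin mulr_ge0.
  apply: eq_integral => y _.
  by rewrite -!EFinM -mulrA likelihood_ratio_mixture.
rewrite -(ge0_integral_marginals
  (f := fun p => (\1_A p * r p.1 p.2)%:E))//; last first.
  by move=> p; rewrite lee_fin mulr_ge0.
rewrite [RHS]integral_mkcond; apply: eq_integral => p _.
by rewrite patchE indicE; case: ifP => _; rewrite ?mul1r ?mul0r.
Qed.

Lemma chi2_informationE :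
  chi2_information S Y = \int[P]_s \int[nu]_y ((r s y - 1) ^+ 2)%:E.
Proof.
rewrite /chi2_information.
rewrite (chi2_density measurable_r joint_has_density) => [|p].
  rewrite ge0_integral_marginals//.
  - by apply/measurable_EFinP; apply: measurable_funX; exact: measurable_funB.
  - by move=> p; rewrite lee_fin sqr_ge0.
exact: r_ge0.
Qed.

End information.

(** * Exponential moments of the distance between two samples *)

(** Jensen's inequality for 1/x: average over t the tangent inequality
    2 / q <= 1 / x + x / q^2 at x = e_t(y), with q the mean of x. *)
Lemma mixtureV_le y : ((q y)^-1)%:E <= \int[P]_t ((tilt sigma t y)^-1)%:E.
Proof.
have q0 := mixture_gt0 sigma_gt0 P y.
have mt : measurable_fun setT (fun t : V => tilt sigma t y).
  exact: measurable_tilt.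
have mtV : measurable_fun setT (fun t : V => ((tilt sigma t y)^-1)%:E).
  by apply/measurable_EFinP/measurable_fun_inv_gt0 => // t; exact: tilt_gt0.
have : \int[P]_t (2 / q y)%:E <=
    \int[P]_t (((tilt sigma t y)^-1)%:E +
                ((q y) ^- 2)%:E * (tilt sigma t y)%:E).
  apply: ge0_le_integral => //.
  - by move=> t _; rewrite lee_fin divr_ge0// ltW.
  - apply: emeasurable_funD => //.
    by apply: measurable_funeM; exact/measurable_EFinP.
  - move=> t _; rewrite -EFinM -EFinD lee_fin.
    have e0 := tilt_gt0 sigma t y; rewrite -subr_ge0.
    rewrite (_ : _ - _ = (q y - tilt sigma t y) ^+ 2 /
                         (tilt sigma t y * q y ^+ 2))%R.
      by rewrite divr_ge0 ?sqr_ge0// mulr_ge0 ?sqr_ge0// ltW.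
    by field; rewrite !gt_eqF.
rewrite integral_cst// [X in _ * X]probability_setT mule1.
rewrite ge0_integralD//; last 3 first.
- by move=> t _; rewrite lee_fin invr_ge0 tilt_ge0.
- by move=> t _; rewrite -EFinM lee_fin mulr_ge0 ?tilt_ge0// invr_ge0 sqr_ge0.
- by apply: measurable_funeM; exact/measurable_EFinP.
rewrite ge0_integralZl//; last 3 first.
- exact/measurable_EFinP.
- by move=> t _; rewrite lee_fin tilt_ge0.
- by rewrite lee_fin invr_ge0 sqr_ge0.
rewrite mixtureE// -EFinM -leeBlDr// -EFinB.
by rewrite (_ : _ - _ = (q y)^-1)%R//; field; rewrite gt_eqF.
Qed.

(** Up to the constant c, e_s^2 / e_t is the exponential of the linear form
    <2 s - t, y> / sigma^2, whose Gaussian integral is known; the exponent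
    (|2 s - t|^2 - 2 |s|^2 + |t|^2) / (2 sigma^2) simplifies to
    |s - t|^2 / sigma^2. *)
Lemma integral_gaussian_tilt2V (s t : V) :
  \int[G]_y (tilt sigma s y ^+ 2 / tilt sigma t y)%:E =
  (expR (sqr_dist s t / sigma ^+ 2))%:E.
Proof.
have s0 : sigma != 0%R by rewrite gt_eqF.
pose a := vec_scale (sigma ^- 2) (vec_sub (vec_scale 2 s) t).
pose c := expR (- (2 * vec_dot s s - vec_dot t t) / 2 / sigma ^+ 2).
transitivity (\int[G]_y (c%:E * (expR (vec_dot a y))%:E)).
  apply: eq_integral => y _; rewrite -EFinM; congr EFin.
  rewrite /tilt /c /a expr2 -!expRD -expRN -expRD; congr expR.
  by rewrite vec_dotZl vec_dotBl vec_dotZl; field.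
have mdot : measurable_fun setT (fun y : V => (expR (vec_dot a y))%:E).
  apply/measurable_EFinP; apply: measurableT_comp => //.
  exact: measurable_vec_dot.
rewrite ge0_integralZl//; last by rewrite lee_fin expR_ge0.
rewrite integral_gaussian_expR_dot// -EFinM /c -expRD; congr (expR _)%:E.
rewrite /a /sqr_dist !(vec_dotZl, vec_dotZr, vec_dotBl, vec_dotBr).
by rewrite (vec_dotC t s); field.
Qed.

Lemma integral_sqr_likelihood_ratio_le (s : V) :
  \int[nu]_y (r s y ^+ 2)%:E <= \int[P]_t (expR (sqr_dist s t / sigma ^+ 2))%:E.
Proof.
have mts : measurable_fun setT (fun y : V => tilt sigma s y).
  exact: measurable_tilt.
have mF : measurable_fun setT
    (fun p : V * V => (tilt sigma s p.2 ^+ 2 / tilt sigma p.1 p.2)%:E).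
  apply/measurable_EFinP; apply: measurable_funM.
    by apply: measurable_funX; exact: (measurableT_comp mts measurable_snd).
  apply: measurable_fun_inv_gt0 => [p|]; first exact: tilt_gt0.
  exact: measurable_tilt.
have F0 (p : V * V) : 0 <= (tilt sigma s p.2 ^+ 2 / tilt sigma p.1 p.2)%:E.
  by rewrite lee_fin divr_ge0 ?sqr_ge0 ?tilt_ge0.
rewrite ge0_integral_mixture//; last 2 first.
- by apply/measurable_EFinP; exact: measurable_funX.
- by move=> y; rewrite lee_fin sqr_ge0.
under [leRHS]eq_integral => t _ do rewrite -integral_gaussian_tilt2V.
rewrite (fubini_tonelli _ mF F0)/=.
apply: ge0_le_integral => //.
- by move=> y _; rewrite -EFinM lee_fin mulr_ge0 ?sqr_ge0// ltW ?mixture_gt0.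
- apply: emeasurable_funM; apply/measurable_EFinP; first exact: measurable_funX.
  exact: measurable_mixture.
- exact: (measurable_fun_fubini_tonelli_G (m1 := P) _ mF F0).
move=> y _; have q0 := mixture_gt0 sigma_gt0 P y.
under eq_integral => t _ do rewrite EFinM.
have mtV : measurable_fun setT (fun t : V => ((tilt sigma t y)^-1)%:E).
  apply/measurable_EFinP/measurable_fun_inv_gt0 => [t|]; first exact: tilt_gt0.
  exact: measurable_tilt.
rewrite ge0_integralZl//; last 2 first.
- by move=> t _; rewrite lee_fin invr_ge0 tilt_ge0.
- by rewrite lee_fin sqr_ge0.
rewrite -EFinM (_ : _ * _ = tilt sigma s y ^+ 2 * (q y)^-1)%R; last first.
  by rewrite /likelihood_ratio; field; rewrite gt_eqF.
by rewrite EFinM lee_wpmul2l ?lee_fin ?sqr_ge0// mixtureV_le.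
Qed.

Lemma measurable_expR_sqr_dist :
  measurable_fun setT
    (fun p : V * V => (expR (sqr_dist p.1 p.2 / sigma ^+ 2))%:E).
Proof.
have msub : measurable_fun setT (fun p : V * V => vec_sub p.1 p.2).
  apply/measurable_fun_tnthP => i.
  have -> : @tnth d R ^~ i \o (fun p : V * V => vec_sub p.1 p.2) =
      fun p : V * V => (tnth p.1 i - tnth p.2 i)%R.
    by apply/funext => p /=; rewrite tnth_mktuple.
  apply: measurable_funB.
    exact: (measurableT_comp (measurable_tnth i) measurable_fst).
  exact: (measurableT_comp (measurable_tnth i) measurable_snd).
apply/measurable_EFinP; apply: measurableT_comp => //.
by apply: measurable_funM => //; exact: measurable_vec_dot.
Qed.

(** The second moment of r bounds its variance, and the estimate for each s is
    integrated over P. *)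
Lemma sqr_dev_le_exp_sqr_dist :
  \int[P]_s \int[nu]_y ((r s y - 1) ^+ 2)%:E <=
  \int[P]_s \int[P]_t (expR (sqr_dist s t / sigma ^+ 2))%:E.
Proof.
apply: ge0_le_integral => //.
- by move=> s _; apply: integral_ge0 => y _; rewrite lee_fin sqr_ge0.
- apply: (measurable_fun_fubini_tonelli_F (m2 := nu)
    (fun p : V * V => ((r p.1 p.2 - 1) ^+ 2)%:E)).
    by apply/measurable_EFinP; apply: measurable_funX; exact: measurable_funB.
  by move=> p; rewrite lee_fin sqr_ge0.
- apply: (measurable_fun_fubini_tonelli_F (m2 := P) _ measurable_expR_sqr_dist).
  by move=> p; rewrite lee_fin expR_ge0.
move=> s _; apply: le_trans (integral_sqr_likelihood_ratio_le s).
rewrite -[leRHS]integral_sqr_dev//; first by rewrite leeDl.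
exact: integral_likelihood_ratio_r.
Qed.

(** Linearize the square: exp (|v|^2 / sigma^2) is the G-integral of
    exp (c <v, x>).  With v = s - t the integrand splits, after centring at the
    mean of P, into a function A of s and a function B of t, to each of which
    the subgaussian inequality applies for fixed x. *)
Lemma exp_sqr_dist_subgaussian_le (K : R) :
  subgaussian P K -> (0 < K)%R -> (K < sigma / 2)%R ->
  \int[P]_s \int[P]_t (expR (sqr_dist s t / sigma ^+ 2))%:E <=
  ((Num.sqrt (1 - 4 * K ^+ 2 / sigma ^+ 2))^-1 ^+ d)%:E.
Proof.
move=> [_ _ subK] K0 Ksigma.
have s0 : sigma != 0%R by rewrite gt_eqF.
(* The Laplace transform of G requires sigma^2 c^2 / 2 = 1 / sigma^2. *)
pose c : R := (Num.sqrt 2 / sigma ^+ 2)%R.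
have cE : (c ^+ 2 = 2 / sigma ^+ 4)%R.
  by rewrite expr_div_n sqr_sqrtr//; field.
pose A (s x : V) := expR (vec_dot (vec_scale c x) (vec_sub s (mean P))).
pose B (t x : V) := expR (vec_dot (vec_scale (- c) x) (vec_sub t (mean P))).
have mexp (k : R) : measurable_fun setT
    (fun p : V * V =>
      (expR (vec_dot (vec_scale k p.2) (vec_sub p.1 (mean P))))%:E).
  apply/measurable_EFinP; apply: measurableT_comp => //.
  rewrite (_ : (fun _ => _) = fun p : V * V =>
    (k * (vec_dot p.2 p.1 - vec_dot p.2 (mean P)))%R); last first.
    by apply/funext => p; rewrite vec_dotZl vec_dotBr.
  apply: measurable_funM => //.
  by apply: measurable_funB; exact: measurable_vec_dot.
have AB s t : (expR (sqr_dist s t / sigma ^+ 2))%:E =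
    \int[G]_x ((A s x)%:E * (B t x)%:E).
  have -> : (sqr_dist s t / sigma ^+ 2 = sigma ^+ 2 *
      vec_dot (vec_scale c (vec_sub s t)) (vec_scale c (vec_sub s t)) / 2)%R.
    by rewrite vec_dotZl vec_dotZr (mulrA c) -expr2 cE /sqr_dist; field.
  rewrite -integral_gaussian_expR_dot//; apply: eq_integral => x _.
  rewrite -EFinM /A /B -expRD; congr (expR _)%:E.
  by rewrite !vec_dotZl vec_dotBl !vec_dotBr !(vec_dotC x); ring.
have A0 s x : 0 <= (A s x)%:E by rewrite lee_fin expR_ge0.
have B0 s x : 0 <= (B s x)%:E by rewrite lee_fin expR_ge0.
have mA_s s : measurable_fun setT (fun x => (A s x)%:E).
  exact: (measurableT_comp (mexp c) (pair1_measurable s)).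
have mA_x x : measurable_fun setT (fun s => (A s x)%:E).
  exact: (measurableT_comp (mexp c) (pair2_measurable x)).
have mB_x x : measurable_fun setT (fun s => (B s x)%:E).
  exact: (measurableT_comp (mexp (- c)%R) (pair2_measurable x)).
have mb : measurable_fun setT (fun x => \int[P]_t (B t x)%:E).
  exact: (measurable_fun_fubini_tonelli_G (m1 := P) _ (mexp (- c)%R)
    (fun p => B0 p.1 p.2)).
have ma : measurable_fun setT (fun x => \int[P]_t (A t x)%:E).
  exact: (measurable_fun_fubini_tonelli_G (m1 := P) _ (mexp c)
    (fun p => A0 p.1 p.2)).
have b0 x : 0 <= \int[P]_t (B t x)%:E by apply: integral_ge0.
have a0 x : 0 <= \int[P]_t (A t x)%:E by apply: integral_ge0.
have -> : \int[P]_s \int[P]_t (expR (sqr_dist s t / sigma ^+ 2))%:E =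
    \int[G]_x ((\int[P]_s (A s x)%:E) * (\int[P]_t (B t x)%:E)).
  transitivity (\int[P]_s \int[G]_x ((A s x)%:E * \int[P]_t (B t x)%:E)).
    apply: eq_integral => s _.
    under eq_integral => t _ do rewrite AB.
    rewrite (fubini_tonelli
      (fun p : V * V => (A s p.2)%:E * (B p.1 p.2)%:E))//=; last 2 first.
    - apply: emeasurable_funM; last exact: (mexp (- c)%R).
      exact: (measurableT_comp (mA_s s) measurable_snd).
    - by move=> p; rewrite mule_ge0.
    by apply: eq_integral => x _; rewrite ge0_integralZl.
  rewrite (fubini_tonelli (fun p : V * V =>
    (A p.1 p.2)%:E * \int[P]_t (B t p.2)%:E))//=; last 2 first.
  - apply: emeasurable_funM; first exact: (mexp c).
    exact: (measurableT_comp mb measurable_snd).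
  - by move=> p; rewrite mule_ge0.
  by apply: eq_integral => x _; rewrite ge0_integralZr.
(* K < sigma / 2 makes exp (2 K^2 |x|^2 / sigma^4) integrable for G. *)
have -> : (1 - 4 * K ^+ 2 / sigma ^+ 2 =
    1 - 2 * (2 * K ^+ 2 / sigma ^+ 4) * sigma ^+ 2)%R by field.
rewrite -integral_gaussian_expR_sqr//; last first.
  rewrite (_ : _ * _ * _ = (2 * K / sigma) ^+ 2)%R; last by field.
  rewrite expr_lt1// ?ltr_pdivrMr// ?mul1r; first by lra.
  by rewrite divr_ge0 ?mulr_ge0// ltW.
apply: ge0_le_integral => //.
- by move=> x _; rewrite mule_ge0.
- exact: emeasurable_funM.
- apply/measurable_EFinP; apply: measurableT_comp => //.
  by apply: measurable_funM => //; exact: measurable_vec_dot.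
move=> x _.
have subK' (k : R) : (k ^+ 2 = c ^+ 2)%R ->
    \int[P]_s (expR (vec_dot (vec_scale k x) (vec_sub s (mean P))))%:E <=
    (expR (K ^+ 2 / sigma ^+ 4 * vec_dot x x))%:E.
  move=> kc; apply: (le_trans (subK _)); rewrite lee_fin ler_expR sqr_vec_norm.
  rewrite vec_dotZl vec_dotZr (mulrA k) -expr2 kc cE.
  by rewrite le_eqVlt; apply/orP; left; apply/eqP; field.
apply: (@le_trans _ _ ((expR (K ^+ 2 / sigma ^+ 4 * vec_dot x x))%:E *
                       (expR (K ^+ 2 / sigma ^+ 4 * vec_dot x x))%:E)).
  by apply: lee_pmul => //; apply: subK'; rewrite ?sqrrN.
rewrite -EFinM -expRD lee_fin ler_expR.
by rewrite le_eqVlt; apply/orP; left; apply/eqP; field.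
Qed.

Lemma exp_sqr_dist_diameter_le (A : set V) (D : R) :
  supported_on P A -> diameter A = D%:E ->
  \int[P]_s \int[P]_t (expR (sqr_dist s t / sigma ^+ 2))%:E <=
  (expR (D ^+ 2 / sigma ^+ 2))%:E.
Proof.
move=> PA AD.
have aeA : {ae P, forall s, A s} by apply: PA.
have dist_le s t : A s -> A t -> (sqr_dist s t <= D ^+ 2)%R.
  move=> As At; rewrite /sqr_dist -sqr_vec_norm.
  have : (vec_norm (vec_sub s t) <= D)%R.
    by rewrite -lee_fin -AD; apply: ereal_sup_ubound; exists s => //; exists t.
  move=> h; rewrite lerXn2r// ?nnegrE ?sqrtr_ge0//.
  by rewrite (le_trans _ h)// sqrtr_ge0.
have mh := measurable_expR_sqr_dist.
have h0 (p : V * V) : 0 <= (expR (sqr_dist p.1 p.2 / sigma ^+ 2))%:E.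
  by rewrite lee_fin expR_ge0.
have cstP (c : R) : \int[P]_s c%:E = c%:E.
  by rewrite integral_cst// [X in _ * X]probability_setT mule1.
rewrite -[leRHS]cstP; apply: ae_ge0_le_integral => //.
- by move=> s _; apply: integral_ge0 => t _; exact: (h0 (s, t)).
- exact: (measurable_fun_fubini_tonelli_F (m2 := P) _ mh h0).
apply: filterS (aeA) => s As _.
rewrite -[leRHS]cstP; apply: ae_ge0_le_integral => //.
- exact: (measurableT_comp mh (pair1_measurable s)).
apply: filterS aeA => t At _.
by rewrite lee_fin ler_expR ler_pM2r ?invr_gt0 ?exprn_gt0// dist_le.
Qed.

End expected_KL_bound.

Theorem proposition5 (R : realType) (d : nat) (hd : (1 <= d)%N)
    (sigma : R) (hsigma : 0 < sigma)
    (P : probability (d.-tuple R) R)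
    (disp : measure_display) (Omega : measurableType disp)
    (Pr : probability Omega R)
    (S Z Y : {RV Pr >-> d.-tuple R})
    (hS : has_law S P)
    (hZ : has_law Z (gaussian sigma))
    (hSZ : independent_RV S Z)
    (hY : forall w, Y w = vec_add (S w) (Z w)) :
  [/\ forall n : nat, (1 <= n)%N ->
        (expected_KL P sigma n <= (n%:R^-1)%:E * chi2_information S Y)%E,
      forall K : R, subgaussian P K -> 0 < K -> K < sigma / 2 ->
        forall n : nat, (1 <= n)%N ->
        (expected_KL P sigma n <=
          (expR (2 * d%:R * (K / sigma) ^+ 2 *
                 ((sigma ^+ 2 - 2 * K ^+ 2) / (sigma ^+ 2 - 4 * K ^+ 2)))
           * n%:R^-1)%:E)%E
    & forall (A : set (d.-tuple R)) (D : R),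
        supported_on P A -> diameter A = D%:E ->
        forall n : nat, (1 <= n)%N ->
        (expected_KL P sigma n <=
          (expR (D ^+ 2 / sigma ^+ 2) * n%:R^-1)%:E)%E ].
Proof.
have s0 : sigma != 0 by rewrite gt_eqF.
split.
- move=> n n0; rewrite (chi2_informationE hsigma hS hZ hSZ hY).
  exact: expected_KL_le.
- move=> K subK K0 Ksigma n n0.
  apply: (le_trans (expected_KL_le hsigma P n0)).
  rewrite mulrC EFinM lee_wpmul2l ?lee_fin ?invr_ge0//.
  apply: (le_trans (sqr_dev_le_exp_sqr_dist hsigma P)).
  apply: (le_trans (exp_sqr_dist_subgaussian_le hsigma subK K0 Ksigma)).
  set w := 1 - 4 * K ^+ 2 / sigma ^+ 2.
  have wE : w = (sigma ^+ 2 - 4 * K ^+ 2) / sigma ^+ 2 by rewrite /w; field.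
  have sK : 0 < sigma ^+ 2 - 4 * K ^+ 2.
    rewrite (_ : _ - _ = (sigma - 2 * K) * (sigma + 2 * K)); last by ring.
    by rewrite mulr_gt0; lra.
  have w0 : 0 < w by rewrite wE divr_gt0// exprn_gt0.
  have w1 : w <= 1.
    by rewrite /w gerBl divr_ge0 ?sqr_ge0// mulr_ge0 ?sqr_ge0.
  rewrite lee_fin (_ : _ * _ = d%:R * ((w^-1 - w) / 4)); last first.
    by rewrite wE; field; rewrite s0 gt_eqF.
  rewrite expRM_natl.
  by rewrite lerXn2r// ?nnegrE ?invr_ge0 ?sqrtr_ge0 ?expR_ge0// sqrtV_le_expR.
- move=> A D PA AD n n0.
  apply: (le_trans (expected_KL_le hsigma P n0)).
  rewrite mulrC EFinM lee_wpmul2l ?lee_fin ?invr_ge0//.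
  apply: (le_trans (sqr_dev_le_exp_sqr_dist hsigma P)).
  exact: exp_sqr_dist_diameter_le PA AD.
Qed.
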